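(* Let $A\in\mathrm{SL}_d(\mathbb{A}_f)$, let $\mathcal{W}\subset\mathbb{A}_f^d$ be a bounded Borel set with $m_f(\partial\mathcal{W})=0$ and $m_f(\mathcal{W})>0$, let $\bm\alpha\in\mathbb{R}^d$ and $c\in[0,1)$. For $\sigma>0$ and $r\in\mathbb{Z}_{\ge0}$ define $$G_{\mathcal{P},\bm\alpha,c}(\sigma,r)=\mu_{\mathrm{ASL}_d(\mathbb{Q})\backslash\mathrm{ASL}_d(\mathbb{A})}\big(\{M : \#(\mathcal{P}(\delta(\mathbb{Q})^dM,\mathcal{W})\cap\mathscr{K}_{c,\sigma})=r\}\big)\quad\text{if }\bm\alpha\notin\mathbb{Q}^d,$$ $$G_{\mathcal{P},\bm\alpha,c}(\sigma,r)=\mu_{\mathrm{SL}_d(\mathbb{Q})\backslash\mathrm{SL}_d(\mathbb{A})}\big(\{M : \#(\mathcal{P}(\delta(\mathbb{Q})^dM,\mathcal{W}_{\bm\beta})\cap\mathscr{K}_{c,\sigma})=r\}\big)\quad\text{if }\bm\alpha\in\mathbb{Q}^d,$$ where in the second case $\bm\beta\in\delta(\mathbb{Q})^d$ satisfies $\bm\alpha=\pi(\bm\beta)$ and $\mathcal{W}_{\bm\beta}=\mathcal{W}-\pi_{\mathrm{int}}(\bm\beta)A_f$. Then for every $r\in\mathbb{Z}_{\ge0}$, the function $\sigma\mapsto G_{\mathcal{P},\bm\alpha,c}(\sigma,r)$ is continuous on $(0,\infty)$.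
   Context: $d\ge2$. $\mathbb{A}=\mathbb{R}\times\mathbb{A}_f$ is the ring of adeles of $\mathbb{Q}$, $\mathbb{A}^d=\mathbb{R}^d\times\mathbb{A}_f^d$, with canonical projections $\pi\colon\mathbb{A}^d\to\mathbb{R}^d$, $\pi_{\mathrm{int}}\colon\mathbb{A}^d\to\mathbb{A}_f^d$; $A\in\mathrm{SL}_d(\mathbb{A}_f)$ is regarded as the element of $\mathrm{SL}_d(\mathbb{A})$ with identity real component, and $A_f=A$. $\delta$ is the diagonal embedding of $\mathbb{Q}^d$ into $\mathbb{A}^d$. $\mathrm{ASL}_d(\mathbb{A})=\mathrm{SL}_d(\mathbb{A})\ltimes\mathbb{A}^d$ acts on row vectors on the right by $\bm x(M,\bm\zeta)=\bm xM+\bm\zeta$. For a discrete set $\mathcal{L}\subset\mathbb{A}^d$ and bounded $\mathcal{W}\subset\mathbb{A}_f^d$, $\mathcal{P}(\mathcal{L},\mathcal{W})=\{\pi(\bm x):\bm x\in\mathcal{L},\ \pi_{\mathrm{int}}(\bm x)\in\mathcal{W}\}$. $m_f$ is the Haar measure on $\mathbb{A}_f^d$ (normalized with $m_f(\widehat{\mathbb{Z}}^d)=1$). The measures $\mu$ are the invariant probability measures on the indicated quotients. $\mathcal{B}^{d-1}$ is the unit ball in $\mathbb{R}^{d-1}$ and $$\mathscr{K}_{c,\sigma}=\Big\{(x_1,\ldots,x_d)\in\mathbb{R}^d : c<x_1<1,\ \|(x_2,\ldots,x_d)\|_2\le\Big(\tfrac{\sigma d}{(1-c^d)m_f(\mathcal{W})\mathrm{vol}(\mathcal{B}^{d-1})}\Big)^{1/(d-1)}x_1\Big\}.$$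 *)

(* Defs.v *)
From HB Require Import structures.
From mathcomp Require Import all_boot all_order all_algebra.
From mathcomp Require Import all_classical all_reals all_analysis.

Set Implicit Arguments.
Unset Strict Implicit.
Unset Printing Implicit Defensive.

Import Order.TTheory GRing.Theory Num.Theory.
Import numFieldNormedType.Exports.

Local Open Scope classical_set_scope.
Local Open Scope ring_scope.

Definition primeT := {p : nat | prime p}.
HB.instance Definition _ := Countable.on primeT.

Definition padic_norm (p : nat) (x : rat) : rat :=
  if x == 0 then 0
  else p%:R ^ ((logn p `|denq x|%N)%:Z - (logn p `|numq x|%N)%:Z).

Section padic_norm_theory.
Variable p : primeT.
Let q := val p.
Let pr_q : prime q := valP p.
Local Notation norm := (padic_norm q).

Lemma padic_p_gt0 : 0 < q%:R :> rat.
Proof. by rewrite ltr0n prime_gt0. Qed.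

Lemma padic_p_gt1 : 1 < q%:R :> rat.
Proof. by rewrite ltr1n prime_gt1. Qed.

Lemma padic_norm0 : norm 0 = 0.
Proof. by rewrite /padic_norm eqxx. Qed.

Lemma padic_norm_ge0 x : 0 <= norm x.
Proof.
by rewrite /padic_norm; case: ifP => // _; rewrite exprz_ge0 // ltW ?padic_p_gt0.
Qed.

Lemma padic_norm_eq0 x : (norm x == 0) = (x == 0).
Proof.
rewrite /padic_norm; case: (eqVneq x 0) => // _.
by apply/negbTE; rewrite expfz_neq0 // gt_eqF ?padic_p_gt0.
Qed.

Lemma padic_norm_frac (a b : int) : a != 0 -> b != 0 ->
  norm (a%:Q / b%:Q) = q%:R ^ ((logn q `|b|%N)%:Z - (logn q `|a|%N)%:Z).
Proof.
move=> a0 b0; set x := _ / _.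
have x0 : x != 0 by rewrite mulf_neq0 ?invr_eq0 ?intr_eq0.
rewrite /padic_norm (negPf x0); congr (_ ^ _).
have eqx : numq x * b = a * denq x.
  have xb : x * b%:Q = a%:Q by rewrite divfK ?intr_eq0.
  by apply: (@intr_inj rat); rewrite !intrM numqE mulrAC xb.
have n0 : numq x != 0 by rewrite numq_eq0.
have d0 : denq x != 0 by rewrite denq_eq0.
have := congr1 (fun z : int => logn q `|z|%N) eqx.
rewrite !abszM !lognM ?absz_gt0 // => e.
by apply/eqP; rewrite subr_eq addrAC eq_sym subr_eq -!PoszD eqz_nat; apply/eqP; rewrite addnC e addnC.
Qed.

Lemma padic_normM x y : norm (x * y) = norm x * norm y.
Proof.
have [->|x0] := eqVneq x 0; first by rewrite mul0r padic_norm0 mul0r.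
have [->|y0] := eqVneq y 0; first by rewrite mulr0 padic_norm0 mulr0.
have -> : x * y = (numq x * numq y)%:Q / (denq x * denq y)%:Q.
  by rewrite -{1}[x]divq_num_den -{1}[y]divq_num_den mulf_div -!intrM.
rewrite padic_norm_frac ?mulf_neq0 ?numq_eq0 ?denq_eq0 //.
rewrite /padic_norm (negPf x0) (negPf y0) -expfzDr ?gt_eqF ?padic_p_gt0 //.
congr (_ ^ _); rewrite !abszM !lognM ?absz_gt0 ?numq_eq0 ?denq_eq0 //.
by rewrite !PoszD opprD addrACA.
Qed.

Lemma padic_norm1 : norm 1 = 1.
Proof. by rewrite /padic_norm oner_eq0 /= logn1 subrr expr0z. Qed.

Lemma padic_normN x : norm (- x) = norm x.
Proof.
by rewrite /padic_norm oppr_eq0 denqN numqN abszN.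
Qed.

Lemma padic_logn_absD (m n : int) k : m + n != 0 ->
  (m != 0 -> (k <= logn q `|m|)%N) -> (n != 0 -> (k <= logn q `|n|)%N) ->
  (k <= logn q `|(m + n)%R|)%N.
Proof.
move=> mn0 hm hn.
have dv (z : int) : (z != 0 -> (k <= logn q `|z|)%N) -> ((q ^ k)%N%:Z %| z)%Z.
  have [-> _|z0 /(_ isT) h] := eqVneq z 0; first exact: dvdz0.
  by rewrite dvdzE /= pfactor_dvdn // absz_gt0.
have := rpredD (dv _ hm) (dv _ hn).
by rewrite dvdzE /= pfactor_dvdn // absz_gt0.
Qed.

Lemma padic_norm_leD x y : norm (x + y) <= Num.max (norm x) (norm y).
Proof.
wlog lexy : x y / norm x <= norm y => [H|].
  by case/orP: (le_total (norm x) (norm y)) => /H //; rewrite addrC maxC.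
rewrite (max_idPr lexy).
have [->|x0] := eqVneq x 0; first by rewrite add0r.
have [y0|y0] := eqVneq y 0.
  by move: lexy; rewrite y0 padic_norm0 addr0.
have [->|s0] := eqVneq (x + y) 0; first by rewrite padic_norm0 padic_norm_ge0.
pose a := numq x * denq y; pose b := numq y * denq x; pose D := denq x * denq y.
have D0 : D != 0 by rewrite mulf_neq0 ?denq_eq0.
have a0 : a != 0 by rewrite mulf_neq0 ?numq_eq0 ?denq_eq0.
have b0 : b != 0 by rewrite mulf_neq0 ?numq_eq0 ?denq_eq0.
have dx0 : (denq x)%:Q != 0 by rewrite intr_eq0 denq_eq0.
have dy0 : (denq y)%:Q != 0 by rewrite intr_eq0 denq_eq0.
have xE : x = a%:Q / D%:Q.
  by rewrite !intrM invfM mulrACA divff // mulr1 divq_num_den.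
have yE : y = b%:Q / D%:Q.
  by rewrite !intrM [(denq x)%:Q * (denq y)%:Q]mulrC invfM mulrACA divff // mulr1 divq_num_den.
have sE : x + y = (a + b)%:Q / D%:Q by rewrite {1}xE {1}yE -mulrDl -intrD.
have ab0 : a + b != 0.
  by apply: contraNneq s0 => ab0; rewrite sE ab0 mul0r.
move: lexy; rewrite sE {1}xE yE !padic_norm_frac // !ler_eXz2l ?padic_p_gt1 //.
rewrite !lerD2l !lerN2 !lez_nat => leba.
by apply: padic_logn_absD.
Qed.

Lemma padic_norm_isosceles x y : norm y < norm x -> norm (x + y) = norm x.
Proof.
move=> lt; apply/le_anti/andP; split.
  by apply: le_trans (padic_norm_leD _ _) _; rewrite ge_max lexx ltW.
have := padic_norm_leD (x + y) (- y); rewrite addrK padic_normN le_max.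
by case/orP => // /le_lt_trans/(_ lt); rewrite ltxx.
Qed.

End padic_norm_theory.

Definition padic_cauchy (p : nat) : {pred nat -> rat} := fun u =>
  `[< forall e, 0 < e ->
      exists N, forall m n, (N <= m)%N -> (N <= n)%N -> padic_norm p (u m - u n) < e >].

Section padic_cauchy_ring.
Variable p : primeT.
Local Notation norm := (padic_norm (val p)).

Lemma padic_cauchy_bounded u : u \in padic_cauchy (val p) ->
  exists2 M, 0 < M & forall n, norm (u n) <= M.
Proof.
move=> /asboolP /(_ 1 ltr01)[N hN].
exists (1 + norm (u N) + \sum_(i < N) norm (u i)).
  by rewrite -addrA ltr_pwDl // addr_ge0 ?padic_norm_ge0 // sumr_ge0 // => i _; exact: padic_norm_ge0.
move=> n; have [Nn|nN] := leqP N n.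
  rewrite -[u n](subrK (u N)); apply: le_trans (padic_norm_leD _ _ _) _.
  apply: (@le_trans _ _ (1 + norm (u N))).
    rewrite ge_max; apply/andP; split; last by rewrite lerDr.
    by rewrite ler_wpDr ?padic_norm_ge0 // ltW // hN.
  by rewrite lerDl sumr_ge0 // => i _; exact: padic_norm_ge0.
rewrite ler_wpDl //; first by rewrite addr_ge0 // padic_norm_ge0.
rewrite (bigD1 (Ordinal nN)) //= lerDl sumr_ge0 // => i _; exact: padic_norm_ge0.
Qed.

Lemma padic_cauchy_subring : subring_closed (padic_cauchy (val p)).
Proof.
split.
- by apply/asboolP => e e0; exists 0%N => m n _ _; rewrite subrr padic_norm0.
- move=> u v /asboolP cu /asboolP cv; apply/asboolP => e e0.
  have [M hM] := cu _ e0; have [N hN] := cv _ e0.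
  exists (maxn M N) => m n; rewrite !geq_max => /andP[Mm Nm] /andP[Mn Nn].
  have -> : (u - v) m - (u - v) n = (u m - u n) + - (v m - v n).
    by rewrite /= !opprD !opprK addrACA.
  apply: le_lt_trans (padic_norm_leD _ _ _) _.
  by rewrite padic_normN gt_max hM // hN.
- move=> u v cu cv; apply/asboolP => e e0.
  have [B B0 hB] := padic_cauchy_bounded cu.
  have [C C0 hC] := padic_cauchy_bounded cv.
  move/asboolP: cu => cu; move/asboolP: cv => cv.
  have [M hM] := cu _ (divr_gt0 e0 C0); have [N hN] := cv _ (divr_gt0 e0 B0).
  exists (maxn M N) => m n; rewrite !geq_max => /andP[Mm Nm] /andP[Mn Nn].
  have -> : (u * v) m - (u * v) n = u m * (v m - v n) + (u m - u n) * v n.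
    by rewrite mulrBr mulrBl addrA subrK.
  apply: le_lt_trans (padic_norm_leD _ _ _) _; rewrite !padic_normM gt_max.
  apply/andP; split.
    apply: (@le_lt_trans _ _ (B * norm (v m - v n))).
      by rewrite ler_wpM2r ?padic_norm_ge0.
    by rewrite mulrC -ltr_pdivlMr // hN.
  apply: (@le_lt_trans _ _ (norm (u m - u n) * C)).
    by rewrite ler_wpM2l ?padic_norm_ge0.
  by rewrite -ltr_pdivlMr // hM.
Qed.

HB.instance Definition _ :=
  GRing.isSubringClosed.Build (nat -> rat) (padic_cauchy (val p)) padic_cauchy_subring.

Record padic_seq := PadicSeq {
  padic_seq_val :> nat -> rat;
  padic_seqP : padic_seq_val \in padic_cauchy (val p) }.

HB.instance Definition _ := [isSub for padic_seq_val].
HB.instance Definition _ := [Choice of padic_seq by <:].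
HB.instance Definition _ := [SubChoice_isSubComNzRing of padic_seq by <:].

Definition padic_null : {pred padic_seq} := fun u =>
  `[< forall e, 0 < e -> exists N, forall n, (N <= n)%N -> norm (u n) < e >].

Lemma padic_null_ideal : idealr_closed padic_null.
Proof.
split.
- by apply/asboolP => e e0; exists 0%N => n _; rewrite padic_norm0.
- apply/negP => /asboolP /(_ 1 ltr01)[N /(_ N (leqnn N))].
  by rewrite padic_norm1 ltxx.
- move=> a u v /asboolP nu /asboolP nv; apply/asboolP => e e0.
  have [B B0 hB] := padic_cauchy_bounded (padic_seqP a).
  have [M hM] := nu _ (divr_gt0 e0 B0); have [N hN] := nv _ e0.
  exists (maxn M N) => n; rewrite geq_max => /andP[Mn Nn].
  apply: le_lt_trans (padic_norm_leD _ _ _) _; rewrite padic_normM gt_max hN // andbT.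
  apply: (@le_lt_trans _ _ (B * norm (u n))).
    by rewrite ler_wpM2r ?padic_norm_ge0.
  by rewrite mulrC -ltr_pdivlMr // hM.
Qed.

HB.instance Definition _ := isIdealr.Build padic_seq padic_null padic_null_ideal.

(* Q_p: p-adic Cauchy sequences of rationals modulo null sequences *)
Definition padic := {ideal_quot padic_null}.
HB.instance Definition _ := GRing.ComNzRing.on padic.
HB.instance Definition _ := Quotient.on padic.

End padic_cauchy_ring.

(* |x|_p: the norms of the terms of a Cauchy sequence representing x != 0 are
   eventually constant; for x = 0 either they are eventually 0 or they have no
   eventual value, and the default 0 of xget is returned. *)
Definition padic_abs (p : primeT) (x : padic p) : rat :=
  xget 0 [set a | exists N, forall n, (N <= n)%N ->
                  padic_norm (val p) (repr x n) = a].

Section padic_abs_theory.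
Variable p : primeT.
Local Notation norm := (padic_norm (val p)).
Local Notation Qp := (padic p).
Local Notation pi := (\pi_Qp)%qT.
Implicit Types (u v w : padic_seq p) (x y : Qp).

Lemma padic_not_nullP w : w \notin @padic_null p ->
  exists2 a, 0 < a & exists N, forall n, (N <= n)%N -> norm (w n) = a.
Proof.
move=> /asboolPn /existsNP[e /not_implyP[e0 /forallNP hw]].
have /asboolP/(_ e e0)[N hN] := padic_seqP w.
have /existsNP[k /not_implyP[Nk /negP]] := hw N; rewrite -leNgt => ek.
exists (norm (w k)); first exact: lt_le_trans ek.
exists N => n Nn; rewrite -[w n](subrK (w k)) addrC padic_norm_isosceles //.
by apply: lt_le_trans ek; exact: hN.
Qed.

Lemma padic_repr_null u : repr (pi u) - u \in @padic_null p.
Proof. by rewrite Quotient.idealrBE reprK. Qed.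

Lemma padic_absP u :
  (u \in @padic_null p /\ padic_abs (pi u) = 0) \/
  [/\ u \notin @padic_null p, 0 < padic_abs (pi u)
    & exists N, forall n, (N <= n)%N -> norm (u n) = padic_abs (pi u)].
Proof.
have hn := padic_repr_null u; set v := repr _ in hn.
have [nu|nu] := boolP (u \in @padic_null p); [left|right].
  split=> //; rewrite /padic_abs -/v.
  have nv : v \in @padic_null p by rewrite -[v](subrK u) rpredD.
  case: xgetP => // a _ [N hN]; apply/eqP/negPn/negP => a0.
  have a_gt0 : 0 < a.
    by rewrite lt_def a0 -(hN N) // padic_norm_ge0.
  have /asboolP/(_ a a_gt0)[M hM] := nv.
  by have := hM (maxn M N) (leq_maxl _ _); rewrite hN ?leq_maxr // ltxx.
have [a a0 [N hN]] := padic_not_nullP nu.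
have /asboolP/(_ a a0)[M hM] := hn.
have hv n : (maxn M N <= n)%N -> norm (v n) = a.
  rewrite geq_max => /andP[Mn Nn].
  have -> : v n = u n + (v - u) n by rewrite /= addrC subrK.
  by rewrite padic_norm_isosceles hN // hM.
have -> : padic_abs (pi u) = a.
  rewrite /padic_abs -/v; case: xgetP => [b _ [K hK]|/(_ a) []].
    by rewrite -(hK (maxn K (maxn M N))) ?leq_maxl // hv // leq_maxr.
  by exists (maxn M N).
by split => //; exists N.
Qed.

Lemma padic_absE u (e : rat) : 0 < e ->
  padic_abs (pi u) <= e <-> exists N, forall n, (N <= n)%N -> norm (u n) <= e.
Proof.
move=> e0; case: (padic_absP u) => [[nu ->]|[nu a0 [N hN]]].
  split=> _; last exact: ltW.
  by have /asboolP/(_ e e0)[N hN] := nu; exists N => n /hN/ltW.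
split=> [le|[M hM]]; first by exists N => n /hN ->.
by rewrite -(hN (maxn M N)) ?leq_maxr // hM // leq_maxl.
Qed.

Lemma padic_abs_ge0 x : 0 <= padic_abs x.
Proof. by rewrite -[x]reprK; case: (padic_absP (repr x)) => [[_ ->]|[_ /ltW]]. Qed.

Lemma padic_abs_eq0 x : (padic_abs x == 0) = (x == 0).
Proof.
rewrite -[x]reprK; set u := repr x.
have -> : (pi u == 0) = (u \in @padic_null p).
  by rewrite -[u]subr0 Quotient.idealrBE subr0 !piE.
case: (padic_absP u) => [[-> ->]|[/negPf -> a0 _]]; first by rewrite eqxx.
by rewrite gt_eqF.
Qed.

Lemma padic_abs0 : padic_abs (0 : Qp) = 0.
Proof. by apply/eqP; rewrite padic_abs_eq0. Qed.

Lemma padic_absM x y : padic_abs (x * y) = padic_abs x * padic_abs y.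
Proof.
have [->|x0] := eqVneq x 0; first by rewrite mul0r padic_abs0 mul0r.
have [->|y0] := eqVneq y 0; first by rewrite mulr0 padic_abs0 mulr0.
move: x0 y0; rewrite -padic_abs_eq0 -[y == 0]padic_abs_eq0.
rewrite -[x]reprK -[y]reprK; set u := repr x; set v := repr y => u0 v0.
case: (padic_absP u) => [[_ e]|[_ _ [N hN]]]; first by rewrite e eqxx in u0.
case: (padic_absP v) => [[_ e]|[_ _ [M hM]]]; first by rewrite e eqxx in v0.
have -> : pi u * pi v = pi (u * v) by rewrite !piE.
have uv n : (maxn N M <= n)%N -> norm ((u * v) n) = padic_abs (pi u) * padic_abs (pi v).
  by rewrite geq_max => /andP[Nn Mn]; rewrite padic_normM hN // hM.
case: (padic_absP (u * v)) => [[nuv _]|[_ _ [K hK]]].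
  have ab0 : 0 < padic_abs (pi u) * padic_abs (pi v).
    by rewrite mulr_gt0 // lt_def ?u0 ?v0 padic_abs_ge0.
  have /asboolP/(_ _ ab0)[K hK] := nuv.
  by have := hK (maxn K (maxn N M)) (leq_maxl _ _); rewrite uv ?leq_maxr // ltxx.
by rewrite -(hK (maxn K (maxn N M))) ?leq_maxl // uv // leq_maxr.
Qed.

Lemma padic_absN x : padic_abs (- x) = padic_abs x.
Proof.
apply/eqP; rewrite -(@eqrXn2 _ 2) // ?padic_abs_ge0 //.
by rewrite !expr2 -!padic_absM mulrNN.
Qed.

Lemma padic_abs_leD x y : padic_abs (x + y) <= Num.max (padic_abs x) (padic_abs y).
Proof.
set m := Num.max _ _.
have [m0|m0] := eqVneq m 0.
  have : padic_abs x <= 0 /\ padic_abs y <= 0.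
    by split; rewrite -m0 le_max lexx ?orbT.
  rewrite !le_eqVlt !(le_gtF (padic_abs_ge0 _)) !orbF !padic_abs_eq0.
  by move=> [/eqP -> /eqP ->]; rewrite addr0 padic_abs0 m0.
have m_gt0 : 0 < m by rewrite lt_def m0 le_max padic_abs_ge0.
have : padic_abs x <= m /\ padic_abs y <= m by split; rewrite le_max lexx ?orbT.
rewrite -[x]reprK -[y]reprK; set u := repr x; set v := repr y.
move=> [/(padic_absE _ m_gt0)[N hN] /(padic_absE _ m_gt0)[M hM]].
have -> : pi u + pi v = pi (u + v) by rewrite !piE.
apply/(padic_absE _ m_gt0); exists (maxn N M) => n; rewrite geq_max => /andP[Nn Mn].
by apply: le_trans (padic_norm_leD _ _ _) _; rewrite ge_max hN // hM.
Qed.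

Lemma padic_abs1 : padic_abs (1 : Qp) = 1.
Proof.
have := padic_absM 1 1; rewrite mulr1 => /eqP.
rewrite -{1}[padic_abs 1]mulr1 -subr_eq0 -mulrBr mulf_eq0 padic_abs_eq0 oner_eq0.
by rewrite subr_eq0 => /eqP <-.
Qed.

Definition padic_cst_subproof (a : rat) : (fun=> a) \in padic_cauchy (val p).
Proof.
by apply/asboolP => e e0; exists 0%N => m n _ _; rewrite subrr padic_norm0.
Qed.

Definition padic_of_rat (a : rat) : Qp := pi (PadicSeq (padic_cst_subproof a)).

Lemma padic_of_rat_abs a : padic_abs (padic_of_rat a) = norm a.
Proof.
rewrite /padic_of_rat; set u := PadicSeq _.
case: (padic_absP u) => [[nu ->]|[_ _ [N /(_ N (leqnn N)) <-]]] //.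
apply/esym/eqP; apply/negPn/negP => a0.
have a_gt0 : 0 < norm a by rewrite lt_def a0 padic_norm_ge0.
by have /asboolP/(_ _ a_gt0)[N /(_ N (leqnn N))] := nu; rewrite ltxx.
Qed.

Lemma padic_of_rat_zmod_morphism : zmod_morphism padic_of_rat.
Proof.
move=> a b; rewrite /padic_of_rat -pi_is_zmod_morphism; congr (pi _).
exact: val_inj.
Qed.

Lemma padic_of_rat_monoid_morphism : monoid_morphism padic_of_rat.
Proof.
split=> [|a b].
  by rewrite /padic_of_rat -(rmorph1 pi); congr (pi _); exact: val_inj.
by rewrite /padic_of_rat -rmorphM; congr (pi _); exact: val_inj.
Qed.

HB.instance Definition _ :=
  GRing.isZmodMorphism.Build rat Qp padic_of_rat padic_of_rat_zmod_morphism.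
HB.instance Definition _ :=
  GRing.isMonoidMorphism.Build rat Qp padic_of_rat padic_of_rat_monoid_morphism.

Definition padic_open (U : set Qp) :=
  forall x, U x -> exists2 e, 0 < e & forall y, padic_abs (y - x) < e -> U y.

Lemma padic_openT : padic_open setT.
Proof. by move=> x _; exists 1. Qed.

Lemma padic_openI : setI_closed padic_open.
Proof.
move=> U V oU oV x [Ux Vx].
have [e e0 he] := oU _ Ux; have [f f0 hf] := oV _ Vx.
exists (Num.min e f); first by rewrite lt_min e0.
by move=> y; rewrite lt_min => /andP[/he ? /hf ?].
Qed.

Lemma padic_open_bigU (I : Type) (f : I -> set Qp) :
  (forall i, padic_open (f i)) -> padic_open (\bigcup_i f i).
Proof.
move=> of_ x [i _ fx]; have [e e0 he] := of_ i _ fx.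
by exists e => // y /he fy; exists i.
Qed.

HB.instance Definition _ :=
  isOpenTopological.Build Qp padic_openT padic_openI padic_open_bigU.

Definition padic_int : set Qp := [set x | padic_abs x <= 1].

End padic_abs_theory.
Arguments padic_int : clear implicits.
Arguments padic_of_rat : clear implicits.

(* A_f: the restricted product of the Q_p with respect to the Z_p *)
Record fin_adele := FinAdele {
  fin_adele_val :> forall p : primeT, padic p;
  fin_adeleP : finite_set [set p | ~ padic_int p (fin_adele_val p)] }.

HB.instance Definition _ := gen_eqMixin fin_adele.
HB.instance Definition _ := gen_choiceMixin fin_adele.

Lemma fin_adele_eq (x y : fin_adele) : (forall p, x p = y p) -> x = y.
Proof.
case: x y => x xP [y yP] /= xy; have e : x = y by exact: functional_extensionality_dep.
by case: _ / e yP => yP; congr FinAdele; exact: Prop_irrelevance.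
Qed.

Section fin_adele_ring.
Implicit Types x y z : fin_adele.

Lemma fin_adele_cst_subproof (a : rat) :
  finite_set [set p : primeT | ~ padic_int p (padic_of_rat p a)].
Proof.
apply: (@sub_finite_set _ _ (val @^-1` [set` primes `|denq a|%N])).
  move=> p /= /negP; rewrite padic_of_rat_abs.
  rewrite mem_primes absz_gt0 denq_neq0 (valP p) /=.
  apply: contraNT => ndvd; rewrite /padic_norm; case: eqP => // _.
  have /eqP -> : logn (val p) `|denq a|%N == 0%N.
    rewrite -leqn0 leqNgt; apply: contra ndvd.
    by rewrite logn_gt0 mem_primes => /and3P[].
  rewrite sub0r -invr_expz invf_le1 ?exprn_gt0 ?padic_p_gt0 //.
  by rewrite exprn_ege1 // ltW // padic_p_gt1.
apply: finite_preimage; last exact: finite_seq.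
by move=> p q _ _; exact: val_inj.
Qed.

Definition fin_adele_of_rat (a : rat) : fin_adele := FinAdele (fin_adele_cst_subproof a).

Lemma fin_adele_opp_subproof x : finite_set [set p | ~ padic_int p (- x p)].
Proof.
by apply: sub_finite_set (fin_adeleP x) => p /=; rewrite /padic_int /= padic_absN.
Qed.

Lemma fin_adele_add_subproof x y : finite_set [set p | ~ padic_int p (x p + y p)].
Proof.
have : finite_set ([set p | ~ padic_int p (x p)] `|` [set p | ~ padic_int p (y p)]).
  by rewrite finite_setU; split; exact: fin_adeleP.
apply: sub_finite_set => p /= xyp; apply/not_andP => -[xp yp]; apply: xyp.
by apply: le_trans (padic_abs_leD _ _) _; rewrite ge_max xp.
Qed.

Lemma fin_adele_mul_subproof x y : finite_set [set p | ~ padic_int p (x p * y p)].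
Proof.
have : finite_set ([set p | ~ padic_int p (x p)] `|` [set p | ~ padic_int p (y p)]).
  by rewrite finite_setU; split; exact: fin_adeleP.
apply: sub_finite_set => p /= xyp; apply/not_andP => -[xp yp]; apply: xyp.
by rewrite /padic_int /= padic_absM mulr_ile1 // padic_abs_ge0.
Qed.

Definition fin_adele_opp x := FinAdele (fin_adele_opp_subproof x).
Definition fin_adele_add x y := FinAdele (fin_adele_add_subproof x y).
Definition fin_adele_mul x y := FinAdele (fin_adele_mul_subproof x y).

Lemma fin_adele_addA : associative fin_adele_add.
Proof. by move=> x y z; apply: fin_adele_eq => p /=; rewrite addrA. Qed.

Lemma fin_adele_addC : commutative fin_adele_add.
Proof. by move=> x y; apply: fin_adele_eq => p /=; rewrite addrC. Qed.

Lemma fin_adele_add0 : left_id (fin_adele_of_rat 0) fin_adele_add.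
Proof. by move=> x; apply: fin_adele_eq => p /=; rewrite rmorph0 add0r. Qed.

Lemma fin_adele_addN : left_inverse (fin_adele_of_rat 0) fin_adele_opp fin_adele_add.
Proof. by move=> x; apply: fin_adele_eq => p /=; rewrite rmorph0 addNr. Qed.

HB.instance Definition _ := GRing.isZmodule.Build fin_adele
  fin_adele_addA fin_adele_addC fin_adele_add0 fin_adele_addN.

Lemma fin_adele_mulA : associative fin_adele_mul.
Proof. by move=> x y z; apply: fin_adele_eq => p /=; rewrite mulrA. Qed.

Lemma fin_adele_mulC : commutative fin_adele_mul.
Proof. by move=> x y; apply: fin_adele_eq => p /=; rewrite mulrC. Qed.

Lemma fin_adele_mul1 : left_id (fin_adele_of_rat 1) fin_adele_mul.
Proof. by move=> x; apply: fin_adele_eq => p /=; rewrite rmorph1 mul1r. Qed.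

Lemma fin_adele_mulDl : left_distributive fin_adele_mul +%R.
Proof. by move=> x y z; apply: fin_adele_eq => p /=; rewrite mulrDl. Qed.

Lemma fin_adele_1neq0 : fin_adele_of_rat 1 != 0.
Proof.
apply/eqP => /(congr1 (fun x : fin_adele => x (exist _ 2%N isT))) /eqP.
by rewrite /= rmorph1 rmorph0 oner_eq0.
Qed.

HB.instance Definition _ := GRing.Zmodule_isComNzRing.Build fin_adele
  fin_adele_mulA fin_adele_mulC fin_adele_mul1 fin_adele_mulDl fin_adele_1neq0.

Lemma fin_adele_of_rat_zmod_morphism : zmod_morphism fin_adele_of_rat.
Proof. by move=> a b; apply: fin_adele_eq => p /=; rewrite rmorphB. Qed.

Lemma fin_adele_of_rat_monoid_morphism : monoid_morphism fin_adele_of_rat.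
Proof. by split=> // a b; apply: fin_adele_eq => p /=; rewrite rmorphM. Qed.

HB.instance Definition _ := GRing.isZmodMorphism.Build rat fin_adele
  fin_adele_of_rat fin_adele_of_rat_zmod_morphism.
HB.instance Definition _ := GRing.isMonoidMorphism.Build rat fin_adele
  fin_adele_of_rat fin_adele_of_rat_monoid_morphism.

End fin_adele_ring.

Section fin_adele_topology.

(* Restricted product topology, with base the products of open sets V_p, all but
   finitely many of which are Z_p. *)
Definition fin_adele_open (U : set fin_adele) := forall x, U x ->
  exists V : forall p, set (padic p),
    [/\ forall p, open (V p) /\ V p (x p),
        finite_set [set p | V p <> padic_int p]
      & forall y : fin_adele, (forall p, V p (y p)) -> U y].

Lemma padic_int_open p : open (padic_int p).
Proof.
move=> x x1; exists 1 => // y yx; rewrite /padic_int /= -[y](subrK x).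
by apply: le_trans (padic_abs_leD _ _) _; rewrite ge_max ltW.
Qed.

Lemma fin_adele_openT : fin_adele_open setT.
Proof.
move=> x _; exists (fun p => [set y | padic_int p (x p) -> padic_int p y]).
split=> // [p|].
  split=> //; have [xp|nxp] := pselect (padic_int p (x p)).
    by rewrite (_ : mkset _ = padic_int p);
      [exact: padic_int_open | apply/seteqP; split=> y //=; apply].
  by rewrite (_ : mkset _ = setT); [exact: openT | apply/seteqP; split=> // y _ /= /nxp].
apply: sub_finite_set (fin_adeleP x) => p /=; apply: contra_not => xp.
by apply/seteqP; split=> y //=; apply.
Qed.

Lemma fin_adele_openI : setI_closed fin_adele_open.
Proof.
move=> U U' oU oU' x [/oU[V [Vx fV VU]] /oU'[V' [Vx' fV' VU']]].
exists (fun p => V p `&` V' p); split.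
- move=> p; have [oV Vp] := Vx p; have [oV' V'p] := Vx' p.
  by split; [exact: openI | split].
- have : finite_set ([set p | V p <> padic_int p] `|` [set p | V' p <> padic_int p]).
    by rewrite finite_setU.
  apply: sub_finite_set => p /= h; apply/not_andP => -[e e']; apply: h.
  by rewrite e e' setIid.
- move=> y Vy; split; first by apply: VU => p; have [] := Vy p.
  by apply: VU' => p; have [] := Vy p.
Qed.

Lemma fin_adele_open_bigU (I : Type) (f : I -> set fin_adele) :
  (forall i, fin_adele_open (f i)) -> fin_adele_open (\bigcup_i f i).
Proof.
move=> of_ x [i _ /of_[V [Vx fV VU]]].
by exists V; split=> // y /VU fy; exists i.
Qed.

HB.instance Definition _ := isOpenTopological.Build fin_adele
  fin_adele_openT fin_adele_openI fin_adele_open_bigU.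
HB.instance Definition _ := isPointed.Build fin_adele 0.

End fin_adele_topology.

Definition adele (R : realType) : Type := (R * fin_adele)%type.
HB.instance Definition _ (R : realType) := GRing.ComNzRing.copy (adele R) (R * fin_adele)%type.
HB.instance Definition _ (R : realType) := Topological.copy (adele R) (R * fin_adele)%type.
HB.instance Definition _ (R : realType) := isPointed.Build (adele R) 0.

Section adele_maps.
Variable R : realType.

Definition adele_of_rat (a : rat) : adele R := (ratr a, fin_adele_of_rat a).

Lemma adele_of_rat_zmod_morphism : zmod_morphism adele_of_rat.
Proof. by move=> a b; rewrite /adele_of_rat !rmorphB. Qed.

Lemma adele_of_rat_monoid_morphism : monoid_morphism adele_of_rat.
Proof. by split=> [|a b]; rewrite /adele_of_rat ?rmorph1 ?rmorphM. Qed.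

HB.instance Definition _ := GRing.isZmodMorphism.Build rat (adele R)
  adele_of_rat adele_of_rat_zmod_morphism.
HB.instance Definition _ := GRing.isMonoidMorphism.Build rat (adele R)
  adele_of_rat adele_of_rat_monoid_morphism.

Definition delta (d : nat) (q : 'rV[rat]_d) : 'rV[adele R]_d := map_mx adele_of_rat q.
Definition pi_inf (d : nat) (x : 'rV[adele R]_d) : 'rV[R]_d :=
  map_mx (fun a : adele R => a.1) x.
Definition pi_int (d : nat) (x : 'rV[adele R]_d) : 'rV[fin_adele]_d :=
  map_mx (fun a : adele R => a.2) x.

End adele_maps.

Definition SL (d : nat) (K : comNzRingType) : Type :=
  set_type [set M : 'M[K]_d | \det M = 1].

Section SL_group.
Variables (d : nat) (K : comNzRingType).
Local Notation SL := (SL d K).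

HB.instance Definition _ := SubChoice.on SL.

Lemma SL_det (M : SL) : \det (val M) = 1.
Proof. exact: (set_valP M). Qed.

Definition SL_of (M : 'M[K]_d) (hM : \det M = 1) : SL := SigSub (mem_set hM).

Lemma SL_one_subproof : \det (1%:M : 'M[K]_d) = 1. Proof. exact: det1. Qed.

Lemma SL_mul_subproof (M N : SL) : \det (val M *m val N) = 1.
Proof. by rewrite det_mulmx !SL_det mulr1. Qed.

Lemma SL_inv_subproof (M : SL) : \det (\adj (val M)) = 1.
Proof. by have := congr1 determinant (mul_mx_adj (val M)); rewrite det_mulmx SL_det mul1r => ->; rewrite det1. Qed.

Definition SL_one := SL_of SL_one_subproof.
Definition SL_mul (M N : SL) := SL_of (SL_mul_subproof M N).
Definition SL_inv (M : SL) := SL_of (SL_inv_subproof M).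

Lemma SL_mulA : associative SL_mul.
Proof. by move=> L M N; apply: val_inj; rewrite /= mulmxA. Qed.

Lemma SL_mul1 : left_id SL_one SL_mul.
Proof. by move=> M; apply: val_inj; rewrite /= mul1mx. Qed.

Lemma SL_mulr1 : right_id SL_one SL_mul.
Proof. by move=> M; apply: val_inj; rewrite /= mulmx1. Qed.

Lemma SL_mulV : left_inverse SL_one SL_inv SL_mul.
Proof. by move=> M; apply: val_inj; rewrite /= mul_adj_mx SL_det. Qed.

Lemma SL_mulrV : right_inverse SL_one SL_inv SL_mul.
Proof. by move=> M; apply: val_inj; rewrite /= mul_mx_adj SL_det. Qed.

HB.instance Definition _ :=
  isGroup.Build SL SL_mulA SL_mul1 SL_mulr1 SL_mulV SL_mulrV.

End SL_group.

Definition ASL (d : nat) (K : comNzRingType) : Type := (SL d K * 'rV[K]_d)%type.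

Section ASL_group.
Variables (d : nat) (K : comNzRingType).
Local Notation ASL := (ASL d K).

HB.instance Definition _ := Choice.on ASL.

Definition ASL_act (x : 'rV[K]_d) (g : ASL) : 'rV[K]_d := x *m val g.1 + g.2.

Definition ASL_one : ASL := (1%g, 0).
Definition ASL_mul (g h : ASL) : ASL := ((g.1 * h.1)%g, ASL_act g.2 h).
Definition ASL_inv (g : ASL) : ASL := ((g.1^-1)%g, - (g.2 *m val (g.1^-1)%g)).

Lemma ASL_mulA : associative ASL_mul.
Proof.
by move=> f g h; congr pair; rewrite /= ?mulgA // /ASL_act /= mulmxDl addrA mulmxA.
Qed.

Lemma ASL_mul1 : left_id ASL_one ASL_mul.
Proof. by move=> [M z]; rewrite /ASL_mul /ASL_act /= mul1g mul0mx add0r. Qed.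

Lemma ASL_mulr1 : right_id ASL_one ASL_mul.
Proof. by move=> [M z]; rewrite /ASL_mul /ASL_act /= mulg1 mulmx1 addr0. Qed.

Lemma ASL_mulV : left_inverse ASL_one ASL_inv ASL_mul.
Proof.
move=> [M z]; rewrite /ASL_mul /ASL_act /= mulVg mulNmx -mulmxA.
have -> : val (M^-1)%g *m val M = 1%:M := congr1 val (mulVg M).
by rewrite mulmx1 addNr.
Qed.

Lemma ASL_mulrV : right_inverse ASL_one ASL_inv ASL_mul.
Proof. by move=> [M z]; rewrite /ASL_mul /ASL_act /= mulgV subrr. Qed.

HB.instance Definition _ :=
  isGroup.Build ASL ASL_mulA ASL_mul1 ASL_mulr1 ASL_mulV ASL_mulrV.

Lemma ASL_actM (x : 'rV[K]_d) (g h : ASL) : ASL_act x (g * h)%g = ASL_act (ASL_act x g) h.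
Proof. by rewrite /ASL_act /= mulmxDl mulmxA addrA. Qed.

End ASL_group.

Section adelic_groups.
Variables (R : realType) (d : nat).
Local Notation A := (adele R).

HB.instance Definition _ := Topological.copy (SL d A)
  (set_type [set M : 'M[A]_d | \det M = 1]).
HB.instance Definition _ := isPointed.Build (SL d A) 1%g.
HB.instance Definition _ := Topological.copy (ASL d A) (SL d A * 'rV[A]_d)%type.
HB.instance Definition _ := isPointed.Build (ASL d A) 1%g.

Lemma SL_delta_subproof (g : SL d rat) : \det (map_mx (@adele_of_rat R) (val g)) = 1.
Proof. by rewrite det_map_mx SL_det rmorph1. Qed.

Definition SL_delta (g : SL d rat) : SL d A := SL_of (SL_delta_subproof g).
Definition ASL_delta (g : ASL d rat) : ASL d A := (SL_delta g.1, delta R g.2).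

Lemma SL_delta_morph : {morph SL_delta : x y / (x * y)%g}.
Proof. by move=> x y; apply: val_inj; rewrite /= map_mxM. Qed.

Lemma ASL_delta_morph : {morph ASL_delta : x y / (x * y)%g}.
Proof.
move=> x y; congr pair; first exact: SL_delta_morph.
by rewrite /delta /ASL_act /= map_mxD map_mxM.
Qed.

Lemma SL_delta1 : SL_delta 1%g = 1%g.
Proof. by apply: val_inj; rewrite /= map_mx1. Qed.

Lemma ASL_delta1 : ASL_delta 1%g = 1%g.
Proof. by congr pair; [exact: SL_delta1 | rewrite /delta /= map_mx0]. Qed.

HB.instance Definition _ := isMultiplicative.Build (SL d rat) (SL d A) SL_delta SL_delta_morph.
HB.instance Definition _ := isMultiplicative.Build (ASL d rat) (ASL d A) ASL_delta ASL_delta_morph.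
HB.instance Definition _ := Multiplicative_isUMagmaMorphism.Build (SL d rat) (SL d A) SL_delta SL_delta1.
HB.instance Definition _ := Multiplicative_isUMagmaMorphism.Build (ASL d rat) (ASL d A) ASL_delta ASL_delta1.

End adelic_groups.

(* As for PreTopologicalNmodule, continuity of the operations is not recorded. *)
#[short(type="preTopologicalGroupType")]
HB.structure Definition PreTopologicalGroup := {G of Group G & PointedTopological G}.

HB.instance Definition _ (R : realType) d := Group.on (SL d (adele R)).
HB.instance Definition _ (R : realType) d := Group.on (ASL d (adele R)).

Section coset_space.
Local Open Scope quotient_scope.
Variables (H : groupType) (G : preTopologicalGroupType) (f : UMagmaMorphism.type H G).

(* Gamma x = Gamma y, where Gamma is the image of f *)
Definition coset_rel : rel G := fun x y => `[< exists h, y = (f h * x)%g >].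

Lemma coset_rel_equiv : equiv_class_of coset_rel.
Proof.
split=> [x|x y|y x z].
- by apply/asboolP; exists 1%g; rewrite gmulf1 mul1g.
- by apply: asbool_equiv_eq; split=> -[h ->]; exists h^-1%g;
    rewrite gmulfV mulKg.
- move=> /asboolP[h ->] /asboolP[k ->]; apply/asboolP; exists (k * h)%g.
  by rewrite gmulfM mulgA.
Qed.

Canonical coset_rel_equivRel := EquivRelPack coset_rel_equiv.
Canonical coset_rel_encModRel := defaultEncModRel coset_rel.

(* Gamma \ G with the quotient topology *)
Definition coset_space : ptopologicalType := quotient_topology {eq_quot coset_rel}.

Definition coset_proj (x : G) : coset_space := (\pi_({eq_quot coset_rel}) x)%qT.

End coset_space.

Definition borel (T : ptopologicalType) := g_sigma_algebraType (@open T).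
HB.instance Definition _ (T : ptopologicalType) := Measurable.on (borel T).

Section invariant_measures.
Local Open Scope ereal_scope.
Variable R : realType.

Definition right_invariant (H : groupType) (G : preTopologicalGroupType)
    (f : UMagmaMorphism.type H G) (mu : set (borel (coset_space f)) -> \bar R) :=
  forall (g : G) (B : set (borel (coset_space f))), measurable B ->
    mu [set coset_proj f (x * g)%g | x in coset_proj f @^-1` B] = mu B.

Definition Zhat (d : nat) : set 'rV[fin_adele]_d :=
  [set x : 'rV[fin_adele]_d | forall i (p : primeT), padic_int p (x 0%R i p)].

(* Regularity is automatic: A_f^d is locally compact and second countable. *)
Definition normalized_haar (d : nat) (m : set (borel 'rV[fin_adele]_d) -> \bar R) :=
  [/\ forall (v : 'rV[fin_adele]_d) (B : set (borel 'rV[fin_adele]_d)),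
        measurable B -> m [set (v + x)%R | x in B] = m B,
      forall C : set 'rV[fin_adele]_d, compact C -> m C < +oo
    & m (@Zhat d) = 1].

End invariant_measures.

Definition SL_space (R : realType) (d : nat) := coset_space (@SL_delta R d).
Definition ASL_space (R : realType) (d : nat) := coset_space (@ASL_delta R d).

Definition boundary (T : topologicalType) (W : set T) : set T := closure W `\` interior W.

Section euclidean.
Variable R : realType.

Definition norm2 (n : nat) (x : 'rV[R]_n) : R := Num.sqrt (\sum_i x 0 i ^+ 2).

Definition unit_ball (n : nat) : set 'rV[R]_n := [set x | norm2 x < 1].

Definition box (n : nat) (ab : 'rV[R]_n * 'rV[R]_n) : set 'rV[R]_n :=
  [set x : 'rV[R]_n | forall i, ab.1 0 i < x 0 i <= ab.2 0 i].

Definition box_vol (n : nat) (ab : 'rV[R]_n * 'rV[R]_n) : R :=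
  \prod_i Num.max 0 (ab.2 0 i - ab.1 0 i).

(* Lebesgue (outer) measure on R^n: infimum of total volumes of countable covers by boxes *)
Definition vol (n : nat) (S : set 'rV[R]_n) : \bar R :=
  ereal_inf [set (\sum_(0 <= k <oo) (box_vol (F k))%:E)%E |
    F in [set F : nat -> 'rV[R]_n * 'rV[R]_n | S `<=` \bigcup_k box (F k)]].

(* K_{c,sigma} in dimension d = n + 2, with w = m_f(W); col' 0 x is (x_2, ..., x_d) *)
Definition cone (n : nat) (w c sigma : R) : set 'rV[R]_n.+2 :=
  [set x : 'rV[R]_n.+2 | c < x 0 0 < 1 /\
    norm2 (col' 0 x) <=
      (sigma * n.+2%:R / ((1 - c ^+ n.+2) * w * fine (vol (@unit_ball n.+1))))
        `^ (n.+1%:R)^-1 * x 0 0].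

End euclidean.

Section adelic_point_sets.
Local Open Scope card_scope.
Variables (R : realType) (d : nat).

(* P(L, W) *)
Definition cut_project (L : set 'rV[adele R]_d) (W : set 'rV[fin_adele]_d) :
    set 'rV[R]_d :=
  [set pi_inf x | x in [set x | L x /\ W (pi_int x)]].

Definition SL_lattice (M : SL d (adele R)) : set 'rV[adele R]_d :=
  [set delta R q *m val M | q in setT].

Definition ASL_lattice (M : ASL d (adele R)) : set 'rV[adele R]_d :=
  [set ASL_act (delta R q) M | q in setT].

Definition SL_count (W : set 'rV[fin_adele]_d) (K : set 'rV[R]_d) (r : nat) :
    set (borel (SL_space R d)) :=
  [set coset_proj (@SL_delta R d) M |
    M in [set M | (cut_project (SL_lattice M) W `&` K) #= `I_r]].

Definition ASL_count (W : set 'rV[fin_adele]_d) (K : set 'rV[R]_d) (r : nat) :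
    set (borel (ASL_space R d)) :=
  [set coset_proj (@ASL_delta R d) M |
    M in [set M | (cut_project (ASL_lattice M) W `&` K) #= `I_r]].

Definition shifted_window (A : SL d fin_adele) (W : set 'rV[fin_adele]_d)
    (beta : 'rV[adele R]_d) : set 'rV[fin_adele]_d :=
  [set w - pi_int beta *m val A | w in W].

End adelic_point_sets.

(* alpha is in Q^d iff alpha = pi(beta) for some beta in delta(Q)^d; beta is then
   unique since delta(Q)^d projects injectively to R^d. *)
Definition Gfun (R : realType) (n : nat)
    (mf : set (borel 'rV[fin_adele]_n.+2) -> \bar R)
    (muSL : set (borel (SL_space R n.+2)) -> \bar R)
    (muASL : set (borel (ASL_space R n.+2)) -> \bar R)
    (A : SL n.+2 fin_adele) (W : set 'rV[fin_adele]_n.+2)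
    (alpha : 'rV[R]_n.+2) (c sigma : R) (r : nat) : R :=
  let K := cone (fine (mf W)) c sigma in
  fine match pselect (exists2 beta, range (@delta R n.+2) beta & alpha = pi_inf beta) with
  | left alphaQ => muSL (SL_count (shifted_window A W (sval (cid2 alphaQ))) K r)
  | right _ => muASL (ASL_count W K r)
  end.

(* Main.v *)
Require Import Defs.
From mathcomp Require Import all_boot all_order all_algebra.
From mathcomp Require Import all_classical all_reals all_analysis.
From mathcomp Require Import measurable_realfun ring lra.

Set Implicit Arguments.
Unset Strict Implicit.
Unset Printing Implicit Defensive.

Import Order.TTheory GRing.Theory Num.Theory.
Import numFieldNormedType.Exports.

Local Open Scope classical_set_scope.
Local Open Scope ring_scope.

(* Let S be the lateral surface of the cone of slope rho. The elements
   diag(s^-(d-1), s, ..., s) of SL_d(R) map S x W to S' x W with S' a cone surface of slope rho s^d. Infinitely many such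
   images are pairwise disjoint inside one bounded set, which contains finitely many
   points of any given adelic lattice; as all images are hit with the same
   probability, that probability is 0. The counts for slopes rho and rho' differ only
   if a point lies in the shell between the two surfaces, and the probability of
   this tends to that of hitting S as rho' tends to rho, again because point counts
   in bounded sets are finite. *)

(** The window is only a Borel set and the coset space only a topological quotient, so the obstacle
    is the measurability of the events that compare counts. Lattice points are therefore indexed by
    rational vectors q: left multiplication by a rational group element permutes the indices, so the
    number of q whose point lies in E is a function on the coset space. It is lower semicontinuous
    for open E, and additivity extends measurability to Borel E inside an open set with finite
    counts. Such a set is a cube times (1/m) Zhat^d; a suitable m exists because the closure of the
    window is compact.

    Equal probabilities come from right invariance, the scaling having finite component 1. Both
    limits follow from one fact: if each adelic point lies in only finitely many E_k, all inside one
    bounded set, then the probability of hitting E_k tends to 0. For the shells it is applied after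
    removing S, whose points lie in all of them. The linear and affine groups share the argument
    through an abstract family of point maps [pt]. *)

(** * p-adic integers and denominators *)

Section padic_integers.
Variable p : primeT.
Implicit Types x y : padic p.

Lemma padic_intD x y : padic_int p x -> padic_int p y -> padic_int p (x + y).
Proof.
by move=> xi yi; apply: le_trans (padic_abs_leD _ _) _; rewrite ge_max xi.
Qed.

Lemma padic_intM x y : padic_int p x -> padic_int p y -> padic_int p (x * y).
Proof. by move=> xi yi; rewrite /padic_int /= padic_absM mulr_ile1 // padic_abs_ge0. Qed.

Lemma padic_intN x : padic_int p x -> padic_int p (- x).
Proof. by rewrite /padic_int /= padic_absN. Qed.

Lemma padic_int_nat m : padic_int p m%:R.
Proof.
elim: m => [|m IH]; first by rewrite /padic_int /= mulr0n padic_abs0.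
by rewrite -addn1 natrD; apply: padic_intD => //; rewrite /padic_int /= padic_abs1.
Qed.

Lemma padic_abs_prime_exp k :
  padic_abs ((val p ^ k)%N%:R : padic p) = (val p)%:R ^- k.
Proof.
rewrite natrX; elim: k => [|k IH]; first by rewrite !expr0 padic_abs1 invr1.
rewrite !exprS padic_absM IH invfM; congr (_ * _).
have pr := valP p; have p0 : (val p != 0)%N by rewrite -lt0n prime_gt0.
have := padic_of_rat_abs p (val p)%:R; rewrite rmorph_nat => ->.
have -> : (val p)%:R = (val p)%:Z%:Q / 1%:Q :> rat by rewrite divr1.
rewrite padic_norm_frac // /= logn1 logn_prime // eqxx sub0r.
by rewrite divr1; exact: (exprN1 (val p)%:R).
Qed.

Lemma padic_prime_exp_small (e : rat) : 0 < e ->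
  exists k, padic_abs ((val p ^ k)%N%:R : padic p) < e.
Proof.
move=> e0; exists (Num.bound e^-1); rewrite padic_abs_prime_exp.
rewrite invf_plt ?posrE ?exprn_gt0 ?padic_p_gt0 //.
have := @archi_boundP rat e^-1; rewrite invr_ge0 ltW // => /(_ isT) h.
apply: lt_le_trans h _; rewrite -natrX ler_nat ltnW // ltn_expl //.
exact: prime_gt1 (valP p).
Qed.

Lemma padic_int_dvd (k m : nat) x : (k %| m)%N ->
  padic_int p (k%:R * x) -> padic_int p (m%:R * x).
Proof.
move=> /dvdnP[j ->] kx; rewrite natrM -mulrA.
by apply: padic_intM => //; exact: padic_int_nat.
Qed.

Lemma padic_denom x : exists k, padic_int p ((val p ^ k)%N%:R * x).
Proof.
(* The added 1 keeps the bound positive when x = 0. *)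
have [k hk] : exists k, padic_abs ((val p ^ k)%N%:R : padic p) < (padic_abs x + 1)^-1.
  apply: padic_prime_exp_small.
  by rewrite invr_gt0 ltr_wpDl // padic_abs_ge0.
exists k; rewrite /padic_int /= padic_absM.
have x1 : 0 < padic_abs x + 1 by rewrite ltr_wpDl // padic_abs_ge0.
apply: (@le_trans _ _ ((padic_abs x + 1)^-1 * (padic_abs x + 1))); last first.
  by rewrite mulVf // gt_eqF.
by apply: ler_pM; rewrite ?padic_abs_ge0 // ?ltW // ltrDl.
Qed.

End padic_integers.

(** Replaces finitely many local moduli by one global integer, so that neighbourhoods and
    denominators in A_f are described by a single m. *)
Lemma prime_powers_multiple (B : set primeT) (k : primeT -> nat) : finite_set B ->
  exists2 m, (0 < m)%N & forall p, B p -> (val p ^ k p %| m)%N.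
Proof.
move=> fB; exists (\prod_(p <- finmap.enum_fset (fset_set B)) val p ^ k p)%N.
  by apply/prodn_gt0 => p; rewrite expn_gt0 prime_gt0 // (valP p).
move=> p Bp; rewrite (big_rem p) /=; last by rewrite in_fset_set // inE.
exact: dvdn_mulr.
Qed.

(** * The ring Zhat of integral finite adeles and the topology of A_f *)

Definition fin_adele_int : set fin_adele := [set x | forall p, padic_int p (x p)].

Section fin_adele_integers.
Implicit Types x y : fin_adele.

Lemma fin_adele_natE m p : (m%:R : fin_adele) p = m%:R.
Proof. by rewrite -[in LHS](rmorph_nat fin_adele_of_rat) /= rmorph_nat. Qed.

Lemma fin_adele_intD x y :
  fin_adele_int x -> fin_adele_int y -> fin_adele_int (x + y).
Proof. by move=> xi yi p; apply: padic_intD. Qed.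

Lemma fin_adele_intM x y :
  fin_adele_int x -> fin_adele_int y -> fin_adele_int (x * y).
Proof. by move=> xi yi p; apply: padic_intM. Qed.

Lemma fin_adele_intN x : fin_adele_int x -> fin_adele_int (- x).
Proof. by move=> xi p; apply: padic_intN. Qed.

Lemma fin_adele_int_nat m : fin_adele_int m%:R.
Proof. by move=> p; rewrite fin_adele_natE; exact: padic_int_nat. Qed.

Lemma fin_adele_int_sum (I : finType) (F : I -> fin_adele) :
  (forall i, fin_adele_int (F i)) -> fin_adele_int (\sum_i F i).
Proof.
move=> Fi; apply: (big_ind fin_adele_int) => //; last exact: fin_adele_intD.
exact: (fin_adele_int_nat 0).
Qed.

Lemma fin_adele_int_dvd (k m : nat) x : (k %| m)%N ->
  fin_adele_int (k%:R * x) -> fin_adele_int (m%:R * x).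
Proof.
move=> /dvdnP[j ->] kx; rewrite natrM -mulrA.
by apply: fin_adele_intM => //; exact: fin_adele_int_nat.
Qed.

Lemma fin_adele_denom x : exists2 m, (0 < m)%N & fin_adele_int (m%:R * x).
Proof.
have /choice[k hk] p := padic_denom (x p).
have [m m0 hm] := prime_powers_multiple k (fin_adeleP x).
exists m => // p; rewrite /= fin_adele_natE.
have [xp|/hm] := pselect (padic_int p (x p)).
  by apply: padic_intM => //; exact: padic_int_nat.
by move=> /padic_int_dvd; apply.
Qed.

Lemma fin_adele_denom_fin (I : finType) (F : I -> fin_adele) :
  exists2 m, (0 < m)%N & forall i, fin_adele_int (m%:R * F i).
Proof.
have /choice[k hk] i : exists m, (0 < m)%N /\ fin_adele_int (m%:R * F i).
  by have [m m0 hm] := fin_adele_denom (F i); exists m.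
exists (\prod_i k i)%N; first by apply/prodn_gt0 => i; case: (hk i).
move=> i; apply: fin_adele_int_dvd (hk i).2.
by rewrite (bigD1 i) //=; exact: dvdn_mulr.
Qed.

Lemma fin_adele_natV m : (0 < m)%N ->
  m%:R * fin_adele_of_rat m%:R^-1 = 1.
Proof.
move=> m0; rewrite -(rmorph_nat fin_adele_of_rat) -rmorphM divff ?rmorph1 //.
by rewrite pnatr_eq0 -lt0n.
Qed.

(* The condition on y says that y lies in x + m Zhat. *)
Lemma fin_adele_nbhsP x (U : set fin_adele) : nbhs x U <->
  exists2 m, (0 < m)%N &
    forall y, fin_adele_int (fin_adele_of_rat m%:R^-1 * (y - x)) -> U y.
Proof.
split.
  rewrite nbhsE => -[B [oB Bx] BU].
  have [V [Vx fV VB]] := oB _ Bx.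
  have /choice[k hk] p : exists k, forall z,
      padic_abs (z - x p) <= padic_abs ((val p ^ k)%N%:R : padic p) -> V p z.
    have [oV Vp] := Vx p; have [e e0 he] := oV _ Vp.
    have [k hk] := padic_prime_exp_small p e0.
    by exists k => z hz; apply: he; exact: le_lt_trans hk.
  have [m m0 hm] := prime_powers_multiple k fV.
  exists m => // y yx; apply/BU/VB => p.
  have yxE : y p - x p = m%:R * (padic_of_rat p m%:R^-1 * (y p - x p)).
    rewrite mulrA -(rmorph_nat (padic_of_rat p)) -rmorphM divff ?rmorph1 ?mul1r //.
    by rewrite pnatr_eq0 -lt0n.
  (* Where [V p] differs from Z_p, divisibility of m by [p ^ k p] brings y_p close to x_p. Elsewhere
     [V p] is Z_p, which contains x_p and the difference. *)
  have [/hm dvd|/contrapT VE] := pselect (V p <> padic_int p).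
    apply: hk; rewrite yxE; move/dvdnP: dvd => [j jE].
    rewrite [in m%:R]jE natrM !padic_absM -mulrA mulrCA ler_piMr ?padic_abs_ge0 //.
    rewrite mulr_ile1 ?padic_abs_ge0 ?mulr_ge0 ?padic_abs_ge0 //.
      exact: padic_int_nat.
    by have := yx p; rewrite /padic_int /= padic_absM.
  rewrite VE -[y p](subrK (x p)) yxE; apply: padic_intD.
    by apply: padic_intM (yx p); exact: padic_int_nat.
  by have [_] := Vx p; rewrite VE.
move=> [m m0 mU]; rewrite nbhsE.
exists [set y | fin_adele_int (fin_adele_of_rat m%:R^-1 * (y - x))]; last first.
  by move=> y; exact: mU.
have mr0 : (m%:R : rat) != 0 by rewrite pnatr_eq0 -lt0n.
split; last by rewrite /= subrr mulr0; exact: (fin_adele_int_nat 0).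
move=> y yx.
(* This factor equals Z_p wherever both x_p and 1/m are p-integral, hence for almost all p. *)
exists (fun p => [set z | padic_int p (padic_of_rat p m%:R^-1 * (z - x p))]).
split.
- move=> p; split; last exact: yx.
  have a0 : 0 < padic_abs (padic_of_rat p m%:R^-1).
    by rewrite lt_def padic_abs_ge0 padic_of_rat_abs padic_norm_eq0 invr_eq0 mr0.
  move=> z zx; exists (padic_abs (padic_of_rat p m%:R^-1))^-1; rewrite ?invr_gt0 //.
  move=> w wz; rewrite /= -[w](subrK z) -addrA mulrDr; apply: padic_intD => //.
  by rewrite /padic_int /= padic_absM mulrC -ler_pdivlMr // mul1r ltW.
- have : finite_set ([set p | ~ padic_int p (x p)] `|`
      [set p | ~ padic_int p (fin_adele_of_rat m%:R^-1 p)]).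
    by rewrite finite_setU; split; exact: fin_adeleP.
  apply: sub_finite_set => p /= h; apply/not_andP => -[xp mp]; apply: h.
  apply/seteqP; split=> z /= zi.
    rewrite -[z](subrK (x p)); apply: padic_intD => //.
    have -> : z - x p = m%:R * (padic_of_rat p m%:R^-1 * (z - x p)).
      by rewrite mulrA -(rmorph_nat (padic_of_rat p)) -rmorphM divff ?rmorph1 ?mul1r.
    by apply: padic_intM => //; exact: padic_int_nat.
  by apply: padic_intM => //; apply: padic_intD => //; exact: padic_intN.
- by move=> z.
Qed.

Lemma fin_adele_add_continuous :
  continuous (fun z : fin_adele * fin_adele => z.1 + z.2).
Proof.
move=> [x y] U /= /fin_adele_nbhsP[m m0 mU].
exists ([set z | fin_adele_int (fin_adele_of_rat m%:R^-1 * (z - x))],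
        [set z | fin_adele_int (fin_adele_of_rat m%:R^-1 * (z - y))]).
  by split; apply/fin_adele_nbhsP; exists m.
move=> [z t] [/= zx ty]; apply: mU; rewrite opprD addrACA mulrDr.
exact: fin_adele_intD.
Qed.

Lemma fin_adele_mull_continuous (a : fin_adele) : continuous (fun x => a * x).
Proof.
move=> x U /= /fin_adele_nbhsP[m m0 mU]; have [k k0 ka] := fin_adele_denom a.
(* k clears the denominators of a, so a maps m k Zhat into m Zhat. *)
apply/fin_adele_nbhsP; exists (m * k)%N; first by rewrite muln_gt0 m0.
move=> y yx; apply: mU; rewrite -mulrBr.
rewrite [X in fin_adele_int X](_ : _ =
  (k%:R * a) * (fin_adele_of_rat (m * k)%:R^-1 * (y - x))).
  exact: fin_adele_intM.
rewrite natrM invfM rmorphM /=; have := fin_adele_natV k0.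
move: (fin_adele_of_rat _) (fin_adele_of_rat _) (y - x) => b c t bk.
by transitivity (k%:R * c * (b * (a * t))); [rewrite bk mul1r | ring].
Qed.

Lemma fin_adele_int_denom_open m :
  open [set x : fin_adele | fin_adele_int (m%:R * x)].
Proof.
rewrite openE => x /= xm; apply/fin_adele_nbhsP; exists 1%N => // y.
rewrite invr1 rmorph1 mul1r /= => yx; rewrite -[y](subrK x) mulrDr.
by apply: fin_adele_intD => //; apply: fin_adele_intM => //; exact: fin_adele_int_nat.
Qed.

(** A prime p dividing the denominator does not divide the numerator, so |a|_p > 1. *)
Lemma fin_adele_int_rat (a : rat) :
  fin_adele_int (fin_adele_of_rat a) -> exists z : int, a = z%:Q.
Proof.
move=> ai; exists (numq a).
suff : `|denq a|%N = 1%N.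
  move=> d1; rewrite -[LHS]divq_num_den -[denq a]gez0_abs ?denq_ge0 // d1.
  by rewrite divr1.
have d0 : (0 < `|denq a|)%N by rewrite absz_gt0 denq_neq0.
apply/eqP; rewrite eqn_leq d0 andbT leqNgt; apply/negP => d1.
have a0 : a != 0 by apply: contraTneq d1 => ->.
pose p : primeT := exist _ (pdiv `|denq a|%N) (pdiv_prime d1).

have pd : (val p %| `|denq a|)%N by exact: pdiv_dvd.
have := ai p; rewrite /padic_int /= padic_of_rat_abs /padic_norm (negPf a0).
have -> : logn (val p) `|numq a|%N = 0%N.
  apply/eqP; rewrite -leqn0 leqNgt logn_gt0 mem_primes; apply/negP => /and3P[_ _ pn].
  have := coprime_num_den a; rewrite /coprime => /eqP g1.
  have : (val p %| gcdn `|numq a| `|denq a|)%N by rewrite dvdn_gcd pn.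
  by rewrite g1 dvdn1 => /eqP p1; have := prime_gt1 (valP p); rewrite p1.
rewrite subr0 leNgt; move/negP; apply; rewrite exprn_egt1 ?padic_p_gt1 //.
by rewrite -lt0n logn_gt0 mem_primes (valP p) d0.
Qed.

End fin_adele_integers.

(** * Measurable functions on Borel spaces *)

(** Open rays generate the Borel sets of the extended reals; lower semicontinuity is the openness of
    their preimages. *)
Lemma borel_lsc_measurable (R : realType) (T : ptopologicalType) (h : borel T -> \bar R) :
  (forall a : R, open [set x : T | (a%:E < h x)%E]) -> measurable_fun setT h.
Proof.
move=> oh; apply: (measurability _ (ErealGenOInfty.measurableE R)).
move=> /= _ [_ [a ->]] <-; rewrite setTI; apply: sub_sigma_algebra.
by rewrite preimage_itvoy; exact: oh.
Qed.

Lemma borel_measurable_funB (R : realType) (T : ptopologicalType)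
    (g h : borel T -> \bar R) :
  measurable_fun setT g -> measurable_fun setT h ->
  measurable_fun setT (g \- h)%E.
Proof. exact: emeasurable_funB. Qed.

Lemma borel_measurable_series (R : realType) (T : ptopologicalType)
    (h : nat -> borel T -> \bar R) :
  (forall k x, 0 <= h k x)%E -> (forall k, measurable_fun setT (h k)) ->
  measurable_fun setT (fun x => \sum_(k <oo | k \in [set: nat]) h k x)%E.
Proof. by move=> h0 mh; apply: ge0_emeasurable_sum => [k x _ _|k _]. Qed.

Lemma borel_measurable_fiber (R : realType) (T : ptopologicalType)
    (h : borel T -> \bar R) (a : R) :
  measurable_fun setT h -> measurable [set x | h x = a%:E].
Proof.
by move=> mh; have := mh measurableT [set a%:E] (emeasurable_set1 _); rewrite setTI.
Qed.

(** * Counting orbit points on a coset space *)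

Section orbit_point_sets.
Context (R : realType) (H : groupType) (G : preTopologicalGroupType).
Context (f : UMagmaMorphism.type H G) (I : countType) (Y : ptopologicalType).
Variable pt : I -> G -> Y.
Hypothesis pt_continuous : forall i, continuous (pt i).
Hypothesis pt_coset : forall h, exists2 tau : I -> I, bijective tau &
  forall M i, pt i (f h * M)%g = pt (tau i) M.
Variable O : set Y.
Hypothesis O_open : open O.
Hypothesis O_finite : forall M, finite_set [set i | O (pt i M)].

Local Notation X := (coset_space f).

Definition hits (E : set Y) (M : G) : set I := [set i | E (pt i M)].

(** An arbitrary choice of representative with no known regularity; what is built on it must be
    shown to depend on the coset alone. *)
Definition coset_lift (x : X) : G := (repr (x : {eq_quot (coset_rel f)}%qT))%qT.

Lemma coset_liftK x : coset_proj f (coset_lift x) = x.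
Proof. exact: reprK. Qed.

Lemma coset_projP M M' :
  coset_proj f M = coset_proj f M' <-> exists h, M' = (f h * M)%g.
Proof.
split => [/eqmodP/asboolP //|h].
by apply/eqmodP/asboolP.
Qed.

Lemma hits_coset_card (E : set Y) (h : H) (M : G) :
  (hits E (f h * M)%g #= hits E M)%card.
Proof.
have [tau [g tauK gK] ptE] := pt_coset h.
rewrite card_eq_sym.
have -> : hits E M = tau @` hits E (f h * M)%g.
  apply/seteqP; split => [i Ei|_ [i Ei <-]]; rewrite /hits /=.
    by exists (g i); rewrite ?gK // /hits /= ptE gK.
  by rewrite -ptE.
by apply: inj_card_eq => i j _ _; exact: can_inj tauK _ _.
Qed.

Lemma hits_lift_card (E : set Y) (M : G) :
  (hits E (coset_lift (coset_proj f M)) #= hits E M)%card.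
Proof.
have /coset_projP[h ->] := esym (coset_liftK (coset_proj f M)).
exact: hits_coset_card.
Qed.

(** Indices are encoded in [nat], where counting is a measure, so that additivity in E is that of a
    measure. *)
Definition hit_count (E : set Y) (x : borel X) : \bar R :=
  counting (pickle @` hits E (coset_lift x)).

Lemma hits_finite E M : E `<=` O -> finite_set (hits E M).
Proof. by move=> EO; apply: sub_finite_set (O_finite M) => i; exact: EO. Qed.

Lemma countingP (T : choiceType) (A : set T) (r : nat) :
  (counting A = r%:R%:E :> \bar R) <-> (A #= `I_r)%card.
Proof.
rewrite /counting; case: asboolP => fA; last first.
  by split => // Ar; exfalso; apply: fA; apply/finite_setP; exists r.
split => [[] /eqP|Ar].
  by rewrite eqr_nat => /eqP Ar; rewrite -[A]fset_setK //; apply/card_eq_fsetP.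
by rewrite (card_fset_set Ar).
Qed.

Lemma hit_countP E x r : hit_count E x = r%:R%:E <-> (hits E (coset_lift x) #= `I_r)%card.
Proof.
have e : (pickle @` hits E (coset_lift x) #= hits E (coset_lift x))%card.
  by apply: inj_card_eq => i j _ _; exact: (pcan_inj pickleK).
rewrite /hit_count countingP; split; apply: card_eq_trans => //.
by rewrite card_eq_sym.
Qed.

(** A finite list of distinct indices witnesses that the count exceeds a, which reduces this to
    finitely many conditions on single points. *)
Lemma hit_count_openP E x (a : R) : finite_set (hits E (coset_lift x)) ->
  (a%:E < hit_count E x)%E <->
  exists s : seq I, [/\ uniq s, forall i, i \in s -> E (pt i (coset_lift x)) & a < (size s)%:R].
Proof.
move=> /[dup] fE /finite_setP[r hr]; rewrite ((hit_countP _ _ _).2 hr) lte_fin.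
split => [ar|[s [us Es as_]]].
  exists (finmap.enum_fset (fset_set (hits E (coset_lift x)))); split.
  - exact: finmap.fset_uniq.
  - by move=> i; rewrite in_fset_set // inE.
  - by rewrite (card_fset_set hr).
apply: lt_le_trans as_ _; rewrite ler_nat -(card_fset_set hr).
by apply: uniq_leq_size => // i /Es Ei; rewrite in_fset_set // inE.
Qed.

Lemma measurable_hit_count_open E : open E -> E `<=` O ->
  measurable_fun setT (hit_count E).
Proof.
move=> oE EO; apply: borel_lsc_measurable => a.
(* Openness in the quotient is tested on the preimage in G, here a union over finite lists of finite
   intersections of preimages of E. *)
rewrite /open /= /quotient_open.
pose U := \bigcup_(s in [set s : seq I | uniq s /\ a < (size s)%:R])
  [set M : G | forall i, i \in s -> E (pt i M)].
have fE M := hits_finite M EO.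
have -> : coset_proj f @^-1` [set x | (a%:E < hit_count E x)%E] = U.
  apply/seteqP; split => [M|M [s /= [us sa] Es]] /=.
    move=> /(hit_count_openP _ (fE _)) [s [us Es sa]].
    have /finite_setP[r hr] := fE M.
    (* The list s belongs to the representative, not to M. Both have equally many hits, so the full
       list for M is long enough. *)
    exists (finmap.enum_fset (fset_set (hits E M))); last first.
      by move=> i; rewrite in_fset_set // inE.
    split; first exact: finmap.fset_uniq.
    have := card_eq_trans (hits_lift_card E M) hr => hr'.
    apply: lt_le_trans sa _; rewrite ler_nat (card_fset_set hr) -(card_fset_set hr').
    by apply: uniq_leq_size => // i /Es Ei; rewrite in_fset_set // inE.
  have /finite_setP[r hr] := fE M.
  have hr' := card_eq_trans (hits_lift_card E M) hr.
  rewrite ((hit_countP _ _ _).2 hr') lte_fin; apply: lt_le_trans sa _.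
  rewrite ler_nat -(card_fset_set hr).
  by apply: uniq_leq_size => // i /Es Ei; rewrite in_fset_set // inE.
apply: bigcup_open => s _; elim: s => [|i s IH].
  by rewrite (_ : mkset _ = setT); [exact: openT | apply/seteqP; split].
rewrite (_ : mkset _ = pt i @^-1` E `&` [set M | forall j, j \in s -> E (pt j M)]).
  by apply: openI => //; apply: open_comp => // M _; exact: pt_continuous.
apply/seteqP; split => [M Es|M [Ei Es] j] /=.
  by split => [|j js]; apply: Es; rewrite in_cons ?eqxx // js orbT.
by rewrite in_cons => /orP[/eqP ->|/Es].
Qed.

Lemma pickle_hits_disj E F x : E `&` F = set0 ->
  (pickle @` hits E x) `&` (pickle @` hits F x) = set0.
Proof.
move=> EF; rewrite -subset0 => _ [[i Ei <-] [j Fj /(pcan_inj pickleK) ji]].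
by rewrite ji in Fj; have : (E `&` F) (pt i x) by []; rewrite EF.
Qed.

(* Dynkin's lemma, starting from open sets, for which the counting function is
   lower semicontinuous. *)
Lemma measurable_hit_count (E : set (borel Y)) : measurable E -> E `<=` O ->
  measurable_fun setT (hit_count E).
Proof.
move=> mE EO.
(* Inside O all counts are finite, so that complements become differences of counts. *)
suff : measurable_fun setT (hit_count (E `&` O)) by rewrite setIidl.
move: E mE {EO}; apply: (@dynkin_induction _ (borel Y) (@open Y)
    (fun E => measurable_fun setT (hit_count (E `&` O)))) => //.
- exact: openI.
- by rewrite setTI; exact: measurable_hit_count_open.
- by move=> E oE; apply: measurable_hit_count_open; [exact: openI|exact: subIsetr].
- move=> E mE NE.
  have -> : hit_count (~` E `&` O) = (hit_count O \- hit_count (E `&` O))%E.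
    apply/funext => x /=.
    have fEO : finite_set (hits (E `&` O) (coset_lift x)) by apply: hits_finite => y [].
    have /finite_setP[r /hit_countP hr] := fEO.
    have -> : hit_count O x = (hit_count (~` E `&` O) x + hit_count (E `&` O) x)%E.
      rewrite /hit_count -measureU //; last first.
        by apply: pickle_hits_disj; rewrite setIACA setICl set0I.
      congr counting; rewrite -image_setU; congr image; apply/seteqP; split => i /=.
        by rewrite /hits /= => Oi; have [] := pselect (E (pt i (coset_lift x))); [right|left].
      by case => -[].
    by rewrite hr addeK.
  apply: borel_measurable_funB; last exact: NE.
  by apply: measurable_hit_count_open.
- move=> F mF tF NF.
  have -> : hit_count (\bigcup_k F k `&` O) =
      (fun x => \sum_(k <oo | k \in [set: nat]) hit_count (F k `&` O) x)%E.
    apply/funext => x; rewrite /hit_count -measure_bigcup //=.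
      congr counting; rewrite -image_bigcup; congr image; apply/seteqP; split => i /=.
        by move=> [[k _ Fk] Oi]; exists k.
      by move=> [k _ [Fk Oi]]; split => //; exists k.
    apply/trivIsetP => j k _ _ jk; apply: pickle_hits_disj.
    by rewrite setIACA; have /trivIsetP -> := tF; rewrite ?set0I.
  by apply: borel_measurable_series => [k x|k]; [exact: measure_ge0|exact: NF].
Qed.

Lemma measurable_hits_card (E : set (borel Y)) r : measurable E -> E `<=` O ->
  measurable [set x : borel X | (hits E (coset_lift x) #= `I_r)%card].
Proof.
move=> mE EO; have mN := measurable_hit_count mE EO.
rewrite (_ : mkset _ = [set x | hit_count E x = r%:R%:E]).
  exact: borel_measurable_fiber.
by apply/seteqP; split => x /hit_countP.
Qed.

Definition hit_set (E : set Y) : set (borel X) :=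
  [set x | exists i, E (pt i (coset_lift x))].

Lemma hit_setP E M : hit_set E (coset_proj f M) <-> exists i, E (pt i M).
Proof.
rewrite /hit_set /=; have := coset_liftK (coset_proj f M).
move: (coset_lift _) => M' /coset_projP[h ->].
have [tau [g tauK gK] ptE] := pt_coset h.
split => -[i Ei]; first by exists (g i); rewrite ptE gK.
by exists (tau i); rewrite -ptE.
Qed.

(** This is the complement of the event that the count is 0. *)
Lemma measurable_hit_set (E : set (borel Y)) : measurable E -> E `<=` O ->
  measurable (hit_set E).
Proof.
move=> mE EO; have := measurable_hits_card 0 mE EO.
move=> /measurableC; congr measurable; apply/seteqP; split => x /=.
  rewrite II0 card_eq0 => /negP/set0P[i Ei]; by exists i.
by move=> [i Ei]; rewrite II0 card_eq0; apply/negP/set0P; exists i.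
Qed.

(* A given point set meets only finitely many of the E k, because it has finitely
   many points in O. *)
Lemma hit_set_cvg0 (mu : probability (borel X) R) (E : nat -> set (borel Y)) :
  (forall k, measurable (E k)) -> (forall k, E k `<=` O) ->
  (forall y, exists k0, forall k, (k0 <= k)%N -> ~ E k y) ->
  mu (hit_set (E k)) @[k --> \oo] --> 0%E.
Proof.
move=> mE EO Efin.
have mh k : measurable (hit_set (E k)) by exact: measurable_hit_set.
have lim0 : lim_sup_set (fun k => hit_set (E k)) = set0.
  rewrite -subset0 => x xE; have [k hk] := choice Efin.
  have [s sE] := (finite_seqP _).1 (O_finite (coset_lift x)).
  (* Beyond the largest threshold of the finitely many indices in s, no point of the orbit lies in
     E_j. *)
  have [j /= kj [i Ei]] := xE (\max_(i <- s) k (pt i (coset_lift x)))%N Logic.I.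
  apply: (hk (pt i (coset_lift x)) j) => //; apply: leq_trans kj.
  apply: leq_bigmax_seq => //.
  by have : [set` s] i by rewrite -sE; exact: EO Ei.
have := @lim_sup_set_cvg _ _ _ mu (fun k => hit_set (E k)) mh.
rewrite lim0 measure0 => /(_ _) h.
(* The tail unions decrease to the empty limit superior, and mu is finite. *)
apply: (@squeeze_cvge _ _ _ _ (cst 0%E) _ (fun n => mu (\bigcup_(k >= n) hit_set (E k)))).
- apply: nearW => k; rewrite measure_ge0 /=; apply: le_measure; rewrite ?inE //.
    exact: bigcup_measurable.
  by move=> x xk; exists k => /=.
- exact: cvg_cst.
- apply: h; apply: le_lt_trans (ltry 1); apply: probability_le1.
  exact: bigcup_measurable.
Qed.

End orbit_point_sets.

(** * Continuity for matrices, adeles and the group actions *)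

Lemma mx_coord_continuous (T : topologicalType) m n i j :
  continuous (fun M : 'M[T]_(m, n) => M i j).
Proof.
move=> M U MU; exists (fun i' j' => [set t | i' = i -> j' = j -> U t]).
  move=> i' j'; have [->|ni] := eqVneq i' i; last first.
    by apply: nearW => t /eqP; rewrite (negPf ni).
  have [->|nj] := eqVneq j' j; last by apply: nearW => t _ /eqP; rewrite (negPf nj).
  by apply: filterS MU => t Ut _ _.
by move=> N /= /(_ i j); apply.
Qed.

Lemma mx_continuousP (S T : topologicalType) m n (g : S -> 'M[T]_(m, n)) :
  (forall i j, continuous (fun x => g x i j)) -> continuous g.
Proof.
move=> gc x U [P MP PU].
have : \forall y \near x, forall ij : 'I_m * 'I_n, P ij.1 ij.2 (g y ij.1 ij.2).
  by apply: filter_forall => ij; exact: gc (MP _ _).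
by apply: filterS => y Py; apply: PU => i j; exact: (Py (i, j)).
Qed.

Lemma continuous_comp2 (S T U V : topologicalType) (op : T * U -> V)
    (g : S -> T) (h : S -> U) :
  continuous op -> continuous g -> continuous h ->
  continuous (fun x => op (g x, h x)).
Proof.
move=> oc gc hc x; apply: (@continuous_comp _ _ _ (fun x => (g x, h x)) op); last exact: oc.
by apply: cvg_pair; [exact: gc|exact: hc].
Qed.

Section adele_topology.
Variable R : realType.

Lemma adele_fst_continuous : continuous (fun a : adele R => a.1).
Proof. by move=> a; exact: cvg_fst. Qed.

Lemma adele_snd_continuous : continuous (fun a : adele R => a.2).
Proof. by move=> a; exact: cvg_snd. Qed.

Lemma adele_pair_continuous (S : topologicalType) (g : S -> R) (h : S -> fin_adele) :
  continuous g -> continuous h -> continuous (fun x => (g x, h x) : adele R).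
Proof.
move=> gc hc x.
by apply: (@cvg_pair _ _ _ _ (nbhs (g x)) (nbhs (h x)) _ _ _ g h); [exact: gc|exact: hc].
Qed.

Lemma adele_add_continuous : continuous (fun z : adele R * adele R => z.1 + z.2).
Proof.
have fc : continuous (fun z : adele R * adele R => z.1) by move=> z; exact: cvg_fst.
have sc : continuous (fun z : adele R * adele R => z.2) by move=> z; exact: cvg_snd.
apply: (@adele_pair_continuous _ (fun z => z.1.1 + z.2.1) (fun z => z.1.2 + z.2.2)).
  apply: (@continuous_comp2 _ _ _ _ (fun t : R * R => t.1 + t.2)
    (fun z : adele R * adele R => z.1.1) (fun z => z.2.1)).
  - by move=> t; apply: cvgD; [exact: cvg_fst|exact: cvg_snd].
  - by move=> z; apply: (continuous_comp (fc z)); exact: adele_fst_continuous.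
  - by move=> z; apply: (continuous_comp (sc z)); exact: adele_fst_continuous.
apply: (@continuous_comp2 _ _ _ _ (fun t : fin_adele * fin_adele => t.1 + t.2)
  (fun z : adele R * adele R => z.1.2) (fun z => z.2.2)).
- exact: fin_adele_add_continuous.
- by move=> z; apply: (continuous_comp (fc z)); exact: adele_snd_continuous.
- by move=> z; apply: (continuous_comp (sc z)); exact: adele_snd_continuous.
Qed.

Lemma adele_mull_continuous (a : adele R) : continuous (fun x => a * x).
Proof.
apply: (@adele_pair_continuous _ (fun z : adele R => a.1 * z.1) (fun z => a.2 * z.2)).
  move=> z; apply: (continuous_comp (@adele_fst_continuous z)).
  exact: mulrl_continuous.
move=> z; apply: (continuous_comp (@adele_snd_continuous z)).
exact: fin_adele_mull_continuous.
Qed.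

Lemma pi_inf_continuous d : continuous (@pi_inf R d).
Proof.
apply: mx_continuousP => i j.
have -> : (fun x : 'rV[adele R]_d => pi_inf x i j) = (fun x => (x i j).1).
  by apply/funext => x; rewrite mxE.
move=> x; apply: (continuous_comp (@mx_coord_continuous _ _ _ i j x)).
exact: adele_fst_continuous.
Qed.

Lemma pi_int_continuous d : continuous (@pi_int R d).
Proof.
apply: mx_continuousP => i j.
have -> : (fun x : 'rV[adele R]_d => pi_int x i j) = (fun x => (x i j).2).
  by apply/funext => x; rewrite mxE.
move=> x; apply: (continuous_comp (@mx_coord_continuous _ _ _ i j x)).
exact: adele_snd_continuous.
Qed.

Lemma SL_val_continuous d : continuous (fun M : SL d (adele R) => val M).
Proof. exact: initial_continuous. Qed.

(** As x is fixed, each coordinate is a sum of constant multiples of entries of M: joint continuity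
    of addition and continuity of multiplication by a constant suffice. *)
Lemma ASL_act_continuous d (x : 'rV[adele R]_d) :
  continuous (fun M : ASL d (adele R) => ASL_act x M).
Proof.
apply: mx_continuousP => i j.
have -> : (fun M : ASL d (adele R) => ASL_act x M i j) =
    (fun M => (\sum_k x i k * val M.1 k j) + M.2 i j).
  by apply/funext => M; rewrite /ASL_act !mxE.
have fc : continuous (fun M : ASL d (adele R) => M.1) by move=> M; exact: cvg_fst.
have sc : continuous (fun M : ASL d (adele R) => M.2) by move=> M; exact: cvg_snd.
apply: (@continuous_comp2 _ _ _ _ (fun t : adele R * adele R => t.1 + t.2)
  (fun M : ASL d (adele R) => \sum_k x i k * val M.1 k j) (fun M => M.2 i j)).
- exact: adele_add_continuous.
- move=> M; apply: cvg_big => [|k _]; first exact: adele_add_continuous.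
  have c1 := continuous_comp (fc M) (@SL_val_continuous d M.1).
  have c2 := continuous_comp c1 (@mx_coord_continuous _ _ _ k j (val M.1)).
  exact: (continuous_comp c2 (@adele_mull_continuous (x i k) _)).
- by move=> M; exact: (continuous_comp (sc M) (@mx_coord_continuous _ _ _ i j M.2)).
Qed.

End adele_topology.

(** * Bounded sets contain finitely many lattice points *)

(** A denominator valid at x is valid for all vectors in x + Zhat^d, a neighbourhood of x.
    Factorials make the local denominators comparable: k! is a multiple of every positive m up to
    k. *)
Lemma compact_fin_adele_denom d (C : set 'rV[fin_adele]_d) : compact C ->
  exists2 m, (0 < m)%N & forall x, C x -> forall j, fin_adele_int (m%:R * x 0 j).
Proof.
move=> /compact_near_coveringP cC.
have [|m _ /(_ m (leqnn m)) hm] := cC nat \oo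
    (fun m x => forall j, fin_adele_int (m`!%:R * x 0 j)) _; last
  by exists (m`!); rewrite ?fact_gt0.
move=> x _; have [m m0 hm] := fin_adele_denom_fin (fun j => x 0 j).
exists ([set y : 'rV_d | forall j, fin_adele_int (y 0 j - x 0 j)], [set k | (m <= k)%N]).
  split; last by exists m.
  have : nbhs x [set y : 'rV[fin_adele]_d | forall j, fin_adele_int (y 0 j - x 0 j)].
    apply: (@filter_forall _ _ (fun j (y : 'rV[fin_adele]_d) =>
      fin_adele_int (y 0 j - x 0 j)) (nbhs x)) => j.
      apply: (@mx_coord_continuous _ _ _ 0 j x [set t | fin_adele_int (t - x 0 j)]).
    by apply/fin_adele_nbhsP; exists 1%N => // y; rewrite invr1 rmorph1 mul1r.
  by [].
move=> [y k] /= [yx mk] j; rewrite -[y 0 j](subrK (x 0 j)) mulrDr.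
apply: fin_adele_intD; last by apply: fin_adele_int_dvd (hm j); rewrite dvdn_fact // m0.
by apply: fin_adele_intM; [exact: fin_adele_int_nat|exact: yx].
Qed.

Lemma adele_fst_sum (R : realType) (I : finType) (F : I -> adele R) :
  (\sum_i F i).1 = \sum_i (F i).1.
Proof. exact: (big_morph fst). Qed.

Lemma adele_snd_sum (R : realType) (I : finType) (F : I -> adele R) :
  (\sum_i F i).2 = \sum_i (F i).2.
Proof. exact: (big_morph snd). Qed.

Section bounded_sets.
Variables (R : realType) (d : nat).

(** Strict real bounds make this set open; it serves as [O] in the counting argument. *)
Definition adele_box (B : R) (m : nat) : set 'rV[adele R]_d :=
  [set x : 'rV[adele R]_d | forall j, `|(x 0 j).1| < B /\ fin_adele_int (m%:R * (x 0 j).2)].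

Lemma adele_box_open B m : open (adele_box B m).
Proof.
rewrite openE => x xB; rewrite /interior.
apply: (@filter_forall _ _ (fun j (y : 'rV[adele R]_d) =>
  `|(y 0 j).1| < B /\ fin_adele_int (m%:R * (y 0 j).2)) (nbhs x)) => j; have [xj1 xj2] := xB j.
apply: (@mx_coord_continuous _ _ _ 0 j x
  [set t : adele R | `|t.1| < B /\ fin_adele_int (m%:R * t.2)]).
exists ([set t | `|t| < B], [set t | fin_adele_int (m%:R * t)]); last by move=> t [].
split => /=.
  apply: open_nbhs_nbhs; split => //.
  apply: (@open_comp _ _ (fun t : R => `|t|) [set t | t < B]) => [t _|].
    exact: norm_continuous.
  exact: open_lt.
by apply: open_nbhs_nbhs; split => //; exact: fin_adele_int_denom_open.
Qed.

(** The product m a is an integer of absolute value at most m B. *)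
Lemma finite_rat_denom (B : R) (m : nat) : (0 < m)%N ->
  finite_set [set a : rat | `|ratr a : R| <= B /\ fin_adele_int (fin_adele_of_rat (m%:R * a))].
Proof.
move=> m0; pose K := Num.bound (m%:R * B).
apply: (@sub_finite_set _ _ ((fun k : nat => (k%:R / m%:R : rat)) @` `I_K
    `|` (fun k : nat => - (k%:R / m%:R : rat)) @` `I_K)); last first.
  by rewrite finite_setU; split; apply: finite_image; exact: finite_II.
move=> a /= [aB /fin_adele_int_rat[z mz]].
have mr : (m%:R : rat) != 0 by rewrite pnatr_eq0 -lt0n.
have aE : a = z%:Q / m%:R by rewrite -mz mulrC mulKf.
have zK : (`|z| < K)%N.
  rewrite -(ltr_nat R); apply: (@le_lt_trans _ _ (m%:R * B)).
    rewrite natr_absz -[X in X%:~R]/(`|z|) intr_norm -(ratr_int R) -mz rmorphM /= normrM.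
    by rewrite ratr_nat normr_nat ler_wpM2l.
  apply: archi_boundP; rewrite mulr_ge0 //; exact: le_trans aB.
case: (lerP 0 z) => z0; [left|right]; exists `|z|%N => //.
  by rewrite aE natr_absz ger0_norm.
by rewrite aE natr_absz ltr0_norm // intrN mulNr opprK.
Qed.

Lemma finite_rV (S : set rat) : finite_set S ->
  finite_set [set q : 'rV[rat]_d | forall j, S (q 0 j)].
Proof.
move=> /finite_seqP[s ->].
have fs : finite_set ((fun g : {ffun 'I_d -> seq_sub s} =>
    (\row_j val (g j) : 'rV[rat]_d)) @` setT).
  by apply: finite_image; exact: finite_finset.
apply: sub_finite_set fs => q qs; exists [ffun j => SeqSub (qs j)] => //.
by apply/rowP => j; rewrite mxE ffunE.
Qed.

(* M is invertible, so bounds on delta(q) M + zeta give a bound on the size and on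
   the denominators of q. *)
Lemma ASL_orbit_finite (M : ASL d (adele R)) (B : R) (m : nat) : (0 < m)%N ->
  finite_set [set q | adele_box B m (ASL_act (delta R q) M)].
Proof.
move=> m0; pose N := \adj (val M.1).
have [k k0 hk] := fin_adele_denom_fin (fun j => (M.2 0 j).2).
have [l l0 hl] := fin_adele_denom_fin (fun ij : 'I_d * 'I_d => (N ij.1 ij.2).2).
(* The factors clear the denominators of the point, of the translation and of the inverse matrix.
   Summing over all i in C gives one bound for every coordinate of q. *)
pose D := (m * k * l)%N; have D0 : (0 < D)%N by rewrite !muln_gt0 m0 k0 l0.
pose C := \sum_i \sum_j (B + `|(M.2 0 j).1|) * `|(N j i).1|.
apply: sub_finite_set (finite_rV (finite_rat_denom C D0)) => q qB i /=.
have qE : adele_of_rat R (q 0 i) =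
    \sum_j (ASL_act (delta R q) M 0 j - M.2 0 j) * N j i.
  have : (ASL_act (delta R q) M - M.2) *m N = delta R q.
    by rewrite /ASL_act addrK -mulmxA mul_mx_adj SL_det mulmx1.
  move=> /(congr1 (fun x : 'rV_d => x 0 i)); rewrite [RHS]mxE => <-.
  by rewrite mxE; apply: eq_bigr => j _; rewrite !mxE.
have B0 (j : 'I_d) : 0 <= B by have [+ _] := qB j => /ltW; exact: le_trans.
split.
  have -> : ratr (q 0 i) = \sum_j ((ASL_act (delta R q) M 0 j).1 - (M.2 0 j).1) * (N j i).1.
    by have := congr1 fst qE; rewrite adele_fst_sum.
  apply: (@le_trans _ _ (\sum_j (B + `|(M.2 0 j).1|) * `|(N j i).1|)).
    apply: le_trans (ler_norm_sum _ _ _) _; apply: ler_sum => j _.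
    rewrite normrM ler_wpM2r //; apply: le_trans (ler_normB _ _) _.
    by rewrite lerD2r ltW //; have [] := qB j.
  rewrite /C [leRHS](bigD1 i) //= lerDl; apply: sumr_ge0 => i' _; apply: sumr_ge0 => j _.
  by rewrite mulr_ge0 // addr_ge0 // (B0 j).
rewrite rmorphM rmorph_nat /=.
have -> : fin_adele_of_rat (q 0 i) =
    \sum_j ((ASL_act (delta R q) M 0 j).2 - (M.2 0 j).2) * (N j i).2.
  by have := congr1 snd qE; rewrite adele_snd_sum.
rewrite mulr_sumr; apply: fin_adele_int_sum => j.
rewrite /D natrM mulrACA.
apply: fin_adele_intM; last exact: (hl (j, i)).
rewrite mulrBr; apply: fin_adele_intD.
  by apply: fin_adele_int_dvd (qB j).2; exact: dvdn_mulr.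
by apply: fin_adele_intN; apply: fin_adele_int_dvd (hk j); exact: dvdn_mull.
Qed.

Lemma pi_infD (x y : 'rV[adele R]_d) : pi_inf (x + y) = pi_inf x + pi_inf y.
Proof. by apply/rowP => j; rewrite !mxE. Qed.

Lemma pi_inf_mulmx (x : 'rV[adele R]_d) (A : 'M[adele R]_d) :
  pi_inf (x *m A) = pi_inf x *m map_mx (fun a : adele R => a.1) A.
Proof.
apply/rowP => j; rewrite mxE [in LHS]mxE adele_fst_sum [RHS]mxE.
by apply: eq_bigr => k _; rewrite [in RHS]mxE [in RHS]mxE.
Qed.

(** The real component of the matrix is invertible and Q embeds in R. Hence counting indices is
    counting real points. *)
Lemma pi_inf_ASL_act_inj (M : ASL d (adele R)) :
  injective (fun q => pi_inf (ASL_act (delta R q) M)).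
Proof.
move=> q q' /=; rewrite /ASL_act !pi_infD => /addIr.
move=> /(congr1 (fun x => x *m map_mx (fun a : adele R => a.1) (\adj (val M.1)))).
rewrite -!pi_inf_mulmx -!mulmxA mul_mx_adj SL_det !mulmx1 => /rowP e.
by apply/rowP => i; have := e i; rewrite !mxE /= => /fmorph_inj.
Qed.

End bounded_sets.

(** * Borel sets and continuous functions *)

Lemma borel_open (T : ptopologicalType) (U : set (borel T)) :
  @open T U -> measurable U.
Proof. by move=> oU; apply: sub_sigma_algebra. Qed.

Lemma borel_closed (T : ptopologicalType) (F : set (borel T)) :
  @closed T F -> measurable F.
Proof.
move=> cF; rewrite -[F]setCK; apply: measurableC; apply: borel_open.
exact: closed_openC.
Qed.

Lemma borel_preimage (S T : ptopologicalType) (g : S -> T) (B : set (borel T)) :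
  continuous g -> measurable B -> measurable (g @^-1` B : set (borel S)).
Proof.
move=> gc mB; have mg : measurable_fun (setT : set (borel S)) (g : borel S -> borel T).
  apply: (measurability (@open T : set (set (borel T))) erefl) => _ [U oU <-].
  by rewrite setTI; apply: borel_open; apply: open_comp => // x _; exact: gc.
by have := mg measurableT B mB; rewrite setTI.
Qed.

Lemma continuous_real_sum (R : realType) (S : topologicalType) (I : finType)
    (F : I -> S -> R) :
  (forall i, continuous (F i)) -> continuous (fun x => \sum_i F i x).
Proof.
move=> Fc x; apply: cvg_big => [|i _]; last exact: Fc.
by move=> t; apply: cvgD; [exact: cvg_fst|exact: cvg_snd].
Qed.

Lemma continuous_real_sub (R : realType) (S : topologicalType) (g h : S -> R) :
  continuous g -> continuous h -> continuous (fun x => g x - h x).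
Proof. by move=> gc hc x; apply: cvgB; [exact: gc|exact: hc]. Qed.

(** * Cones, shells and lateral surfaces *)

Section shells.
Variables (R : realType) (n : nat).
Implicit Types (c a lo hi : R) (x : 'rV[R]_n.+2).

(** [lo = 0] gives a cone and [lo = hi] a lateral surface; the factor [a] on the axis accommodates
    scaled images. *)
Definition shell c a lo hi : set 'rV[R]_n.+2 :=
  [set x : 'rV[R]_n.+2 | c < a * x 0 0 < 1 /\ lo * x 0 0 <= norm2 (col' 0 x) <= hi * x 0 0].

Lemma norm2_ge0 m (x : 'rV[R]_m) : 0 <= norm2 x.
Proof. exact: sqrtr_ge0. Qed.

Lemma norm2_coord m (x : 'rV[R]_m) i : `|x 0 i| <= norm2 x.
Proof.
rewrite -sqrtr_sqr; apply: ler_wsqrtr; rewrite (bigD1 i) //= lerDl.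
by apply: sumr_ge0 => j _; exact: sqr_ge0.
Qed.

Lemma norm2_continuous m : continuous (@norm2 R m).
Proof.
have sc : continuous (fun x : 'rV[R]_m => \sum_i x 0 i ^+ 2).
  apply: continuous_real_sum => i x.
  exact: (continuous_comp (@mx_coord_continuous _ _ _ 0 i x) (@exprn_continuous _ 2 _)).
by move=> x; exact: (continuous_comp (sc x) (@sqrt_continuous R _)).
Qed.

Lemma norm2_col'_continuous : continuous (fun x => norm2 (col' 0 x)).
Proof.
move=> x; apply: (@continuous_comp _ _ _ (fun x : 'rV[R]_n.+2 => col' 0 x) (@norm2 R _)).
  move: x; apply: mx_continuousP => i j.
  have -> : (fun x : 'rV[R]_n.+2 => col' 0 x i j) = fun x => x i (lift 0 j).
    by apply/funext => x; rewrite mxE.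
  exact: mx_coord_continuous.
exact: norm2_continuous.
Qed.

Lemma measurable_shell c a lo hi :
  measurable (shell c a lo hi : set (borel 'rV[R]_n.+2)).
Proof.
have cx b : continuous (fun x : 'rV[R]_n.+2 => b * x 0 0).
  move=> x; apply: (@continuous_comp _ _ _ (fun x : 'rV[R]_n.+2 => x 0 0) (fun t => b * t)).
    exact: mx_coord_continuous.
  exact: mulrl_continuous.
have cN := norm2_col'_continuous.
have -> : shell c a lo hi = (fun x => a * x 0 0) @^-1` `]c, 1[ `&`
    ((fun x => norm2 (col' 0 x) - lo * x 0 0) @^-1` [set t | 0 <= t] `&`
     (fun x => hi * x 0 0 - norm2 (col' 0 x)) @^-1` [set t | 0 <= t]).
  apply/seteqP; split => x /=; rewrite in_itv /= !subr_ge0.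
    by move=> [? /andP[? ?]].
  by move=> [xc [xl xh]]; split=> //; apply/andP.
apply: measurableI; [|apply: measurableI].
- apply: borel_open; apply: open_comp; first by move=> x _; exact: cx.
  exact: interval_open.
- apply: borel_closed; apply: preimage_closed; last exact: closed_ge.
  by move=> x _; exact: (continuous_real_sub cN (cx lo)).
- apply: borel_closed; apply: preimage_closed; last exact: closed_ge.
  by move=> x _; exact: (continuous_real_sub (cx hi) cN).
Qed.

(** The bound depends only on P, so one box serves a whole sequence of shells. Since [a >= 1], x_1
    stays below 1 and the remaining coordinates have norm at most P. *)
Lemma shell_bounded c a lo hi P x : 0 <= c -> 1 <= a -> hi <= P -> 0 <= P ->
  shell c a lo hi x -> forall j, `|x 0 j| < P + 2.
Proof.
move=> c0 a1 hP P0 [/andP[cx x1] /andP[_ xhi]] j.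
have a0 : 0 < a by apply: lt_le_trans a1.
have x0 : 0 < x 0 0 by rewrite -(pmulr_rgt0 _ a0); exact: le_lt_trans cx.
have x01 : x 0 0 < 1 by apply: le_lt_trans x1; rewrite ler_peMl // ltW.
have [k ->|->] := unliftP 0 j; last by rewrite gtr0_norm //; lra.
have : `|x 0 (lift 0 k)| <= norm2 (col' 0 x).
  by have := norm2_coord (col' 0 x) k; rewrite mxE.
have : hi * x 0 0 <= P by nra.
lra.
Qed.

Lemma cone_shell w c sigma : 0 <= c ->
  cone w c sigma = shell c 1 0 ((sigma * n.+2%:R /
    ((1 - c ^+ n.+2) * w * fine (vol (@unit_ball R n.+1)))) `^ (n.+1%:R)^-1).
Proof.
move=> c0; apply/seteqP; split => x; rewrite /cone /shell /= mul1r mul0r norm2_ge0 //.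
Qed.

(** Since c >= 0 forces x_1 > 0, slopes can be compared after multiplication by x_1; the norm lies
    between rho2 x_1 and rho1 x_1. *)
Lemma shell_diff c lo hi rho1 rho2 x : 0 <= c ->
  lo <= rho1 <= hi -> lo <= rho2 <= hi ->
  shell c 1 0 rho1 x -> ~ shell c 1 0 rho2 x -> shell c 1 lo hi x.
Proof.
move=> c0 /andP[l1 h1] /andP[l2 h2] [cx]; rewrite mul0r norm2_ge0 /= => x1 nx2.
split => //; move: (cx); rewrite mul1r => /andP[cx0 _].
have x0 : 0 < x 0 0 by exact: le_lt_trans cx0.
have : ~~ (norm2 (col' 0 x) <= rho2 * x 0 0).
  by apply/negP => x2; apply: nx2; split; rewrite // mul0r norm2_ge0.
by rewrite -ltNge => x2; apply/andP; split; nra.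
Qed.

End shells.

(** * Real diagonal scalings in SL_d(A) *)

Section real_scaling.
Variables (R : realType) (n : nat).

(** The finite component 1 leaves the finite parts of points, hence the window condition,
    unchanged. *)
Definition adele_real (s : R) : adele R := (s, 1).

Lemma adele_realM s t : adele_real s * adele_real t = adele_real (s * t).
Proof. by congr pair; rewrite mulr1. Qed.

Lemma adele_realX s k : adele_real s ^+ k = adele_real (s ^+ k).
Proof. by elim: k => // k IH; rewrite !exprS IH adele_realM. Qed.

Definition scaling_row (s : R) : 'rV[adele R]_n.+2 :=
  \row_j if j == 0 then adele_real (s ^- n.+1) else adele_real s.

Lemma scaling_det s : s != 0 -> \det (diag_mx (scaling_row s)) = 1.
Proof.
move=> s0; rewrite det_diag big_ord_recl mxE eqxx.
rewrite (eq_bigr (fun=> adele_real s)) => [|i _]; last by rewrite mxE.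
rewrite prodr_const card_ord adele_realX adele_realM mulVf //.
by rewrite expf_neq0.
Qed.

Definition real_scaling s (s0 : s != 0) : SL n.+2 (adele R) := SL_of (scaling_det s0).

Lemma mulmx_scaling (x : 'rV[adele R]_n.+2) s (s0 : s != 0) j :
  (x *m val (real_scaling s0)) 0 j = x 0 j * scaling_row s 0 j.
Proof. by rewrite /= mul_mx_diag mxE. Qed.

Lemma pi_int_scaling (x : 'rV[adele R]_n.+2) s (s0 : s != 0) :
  pi_int (x *m val (real_scaling s0)) = pi_int x.
Proof.
apply/rowP => j; rewrite mxE mulmx_scaling [RHS]mxE mxE.
by case: eqP => _; exact: mulr1.
Qed.

Lemma pi_inf_scaling0 (x : 'rV[adele R]_n.+2) s (s0 : s != 0) :
  pi_inf (x *m val (real_scaling s0)) 0 0 = pi_inf x 0 0 * s ^- n.+1.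
Proof. by rewrite mxE mulmx_scaling [in RHS]mxE mxE. Qed.

Lemma pi_inf_scaling_lift (x : 'rV[adele R]_n.+2) s (s0 : s != 0) i :
  pi_inf (x *m val (real_scaling s0)) 0 (lift 0 i) = pi_inf x 0 (lift 0 i) * s.
Proof. by rewrite mxE mulmx_scaling [in RHS]mxE mxE. Qed.

(** x_1 is divided by s^(d-1) and the other coordinates are multiplied by s, with d = n + 2. The
    axis factor s^(d-1) undoes the shrinking of x_1. *)
Lemma shell_scaling (x : 'rV[adele R]_n.+2) (s : R) (s0 : 0 < s) (c rho : R) :
  shell c (s ^+ n.+1) (rho * s ^+ n.+2) (rho * s ^+ n.+2)
    (pi_inf (x *m val (real_scaling (lt0r_neq0 s0)))) <->
  shell c 1 rho rho (pi_inf x).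
Proof.
have sn0 : s ^+ n.+1 != 0 by rewrite expf_neq0 // lt0r_neq0.
rewrite /shell /mkset.
rewrite pi_inf_scaling0 mul1r.
rewrite [_ * (_ / _)]mulrCA divff // mulr1.
have -> : norm2 (col' 0 (pi_inf (x *m val (real_scaling (lt0r_neq0 s0))))) =
    s * norm2 (col' 0 (pi_inf x)).
  rewrite /norm2 -[X in _ = X * _](gtr0_norm s0) -sqrtr_sqr -sqrtrM ?sqr_ge0 //.
  congr Num.sqrt; rewrite mulr_sumr; apply: eq_bigr => i _.
  by rewrite mxE pi_inf_scaling_lift [in RHS]mxE exprMn mulrC.
have -> : rho * s ^+ n.+2 * (pi_inf x 0 0 / s ^+ n.+1) = s * (rho * pi_inf x 0 0).
  by rewrite exprSr; field.
by rewrite !ler_pM2l.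
Qed.

End real_scaling.

(** * Comparison of probabilities, and adelic windows *)

Lemma probability_dist_le d (T : measurableType d) (R : realType)
    (P : probability T R) (A B C : set T) :
  measurable A -> measurable B -> measurable C ->
  A `<=` B `|` C -> B `<=` A `|` C ->
  `|fine (P A) - fine (P B)| <= fine (P C).
Proof.
have aux (A' B' : set T) : measurable A' -> measurable B' -> measurable C ->
    A' `<=` B' `|` C -> fine (P A') <= fine (P B') + fine (P C).
  move=> mA mB mC ABC; rewrite -fineD ?fin_num_measure // fine_le ?fin_num_measure //.
    by rewrite fin_numD !fin_num_measure.
  apply: le_trans (measureU2 P mB mC); apply: le_measure; rewrite ?inE //.
  exact: measurableU.
move=> mA mB mC AB BA; have h1 := aux _ _ mA mB mC AB; have h2 := aux _ _ mB mA mC BA.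
by rewrite ler_norml; apply/andP; split; lra.
Qed.

Section windows.
Variables (R : realType) (d : nat).

Definition window (K : set 'rV[R]_d) (W : set 'rV[fin_adele]_d) : set 'rV[adele R]_d :=
  [set x | K (pi_inf x) /\ W (pi_int x)].

Lemma measurable_window (K : set 'rV[R]_d) (W : set 'rV[fin_adele]_d) :
  measurable (K : set (borel 'rV[R]_d)) ->
  measurable (W : set (borel 'rV[fin_adele]_d)) ->
  measurable (window K W : set (borel 'rV[adele R]_d)).
Proof.
move=> mK mW; apply: (@measurableI _ (borel 'rV[adele R]_d)
  (@pi_inf R d @^-1` K) (@pi_int R d @^-1` W)).
  by apply: (borel_preimage _ mK); exact: pi_inf_continuous.
by apply: (borel_preimage _ mW); exact: pi_int_continuous.
Qed.

Lemma window_box (K : set 'rV[R]_d) (W : set 'rV[fin_adele]_d) B m :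
  (forall x, K x -> forall j, `|x 0 j| < B) ->
  (forall x, W x -> forall j, fin_adele_int (m%:R * x 0 j)) ->
  window K W `<=` adele_box B m.
Proof.
move=> KB Wm x [Kx Wx] j; have := KB _ Kx j; have := Wm _ Wx j.
by rewrite !mxE.
Qed.

End windows.

(** * Continuity of the probabilities in the slope *)

Section cone_counts.
Variables (R : realType) (n : nat) (H : groupType) (G : preTopologicalGroupType).
Variables (f : UMagmaMorphism.type H G) (pt : 'rV[rat]_n.+2 -> G -> 'rV[adele R]_n.+2).
Hypothesis pt_continuous : forall q, continuous (pt q).
Hypothesis pt_coset : forall h, exists2 tau : 'rV[rat]_n.+2 -> 'rV[rat]_n.+2,
  bijective tau & forall M q, pt q (f h * M)%g = pt (tau q) M.
Hypothesis pt_finite : forall M (B : R) m, (0 < m)%N ->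
  finite_set [set q | adele_box B m (pt q M)].
Hypothesis pt_inj : forall M, injective (fun q => pi_inf (pt q M)).
Hypothesis pt_scaling : forall (s : R) (s0 : s != 0), exists g,
  forall q M, pt q (M * g)%g = pt q M *m val (@real_scaling R n s s0).
Variables (mu : probability (borel (coset_space f)) R) (W : set 'rV[fin_adele]_n.+2).
Variables (m : nat) (c : R).
Hypothesis mu_inv : right_invariant mu.
Hypothesis W_measurable : measurable (W : set (borel 'rV[fin_adele]_n.+2)).
Hypothesis m_gt0 : (0 < m)%N.
Hypothesis W_denom : forall x, W x -> forall j, fin_adele_int (m%:R * x 0 j).
Hypothesis c_ge0 : 0 <= c.

(** Phrased so that [SL_count] and [ASL_count] of a cone are instances by conversion. *)
Definition cone_count (rho : R) (r : nat) : set (borel (coset_space f)) :=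
  [set coset_proj f M | M in [set M |
    (cut_project (range (pt^~ M)) W `&` shell c 1 0 rho #= `I_r)%card]].

(** Points correspond to indices by [pt_inj], and the number of indices is constant on cosets, so
    any representative decides membership. *)
Lemma cone_countE rho r : cone_count rho r =
  [set x | (hits pt (window (shell c 1 0 rho) W) (coset_lift x) #= `I_r)%card].
Proof.
have cardE M : (cut_project (range (pt^~ M)) W `&` shell c 1 0 rho #=
    hits pt (window (shell c 1 0 rho) W) M)%card.
  rewrite [X in (X #= _)%card](_ : _ =
    (fun q => pi_inf (pt q M)) @` hits pt (window (shell c 1 0 rho) W) M).
    by apply: inj_card_eq => q q' _ _; exact: pt_inj.
  apply/seteqP; split => [_ [[_ [[q _ <-] Wq] <-] Kq]|_ [q [Kq Wq] <-]].
    by exists q.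
  by split => //; exists (pt q M) => //; split => //; exists q.
apply/seteqP; split => [_ [M Mr <-]|x xr] /=.
  apply: (card_eq_trans (hits_lift_card pt_coset _ M)).
  by apply: card_eq_trans Mr; rewrite card_eq_sym; exact: cardE.
exists (coset_lift x); last exact: coset_liftK.
exact: (card_eq_trans (cardE _) xr).
Qed.

Lemma shell_window_box a lo hi P : 1 <= a -> hi <= P -> 0 <= P ->
  window (shell c a lo hi) W `<=` adele_box (P + 2) m.
Proof.
move=> a1 hP P0; apply: window_box => // x xK.
exact: (shell_bounded c_ge0 a1 hP P0 xK).
Qed.

Lemma cone_surface_null (rho : R) : 0 < rho ->
  mu (hit_set (f := f) pt (window (shell c 1 rho rho) W)) = 0%E.
Proof.
(* Distinct scales in (1, 2]: distinct slopes make the images disjoint, and the bound 2 keeps them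
   in one box. *)
move=> rho0; pose s k : R := 1 + k.+1%:R^-1.
have s1 k : 1 <= s k by rewrite lerDl invr_ge0.
have s2 k : s k <= 2 by rewrite /s -[2]/(1 + 1) lerD2l invf_le1 // ler1n.
have s0 k : 0 < s k by apply: lt_le_trans (s1 k).
pose E k := window (shell c (s k ^+ n.+1) (rho * s k ^+ n.+2) (rho * s k ^+ n.+2)) W.
have hitE k : mu (hit_set (f := f) pt (E k)) =
    mu (hit_set (f := f) pt (window (shell c 1 rho rho) W)).
  have [g gE] := pt_scaling (lt0r_neq0 (s0 k)).
  have Eg q M : E k (pt q (M * g)%g) <-> window (shell c 1 rho rho) W (pt q M).
    rewrite gE; split => -[h1 h2].
      by split; [move/shell_scaling: h1|rewrite pi_int_scaling in h2].
    by split; [apply/shell_scaling|rewrite pi_int_scaling].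
  (* Right translation by g carries the cosets hitting the surface onto those hitting [E k]. *)
  rewrite -[RHS](mu_inv g); last first.
    apply: (measurable_hit_set R pt_continuous pt_coset (@adele_box_open R _ (rho + 2) m)).
    - by move=> M; exact: pt_finite.
    - by apply: measurable_window => //; exact: measurable_shell.
    - by apply: shell_window_box => //; exact: ltW.
  congr (mu _); apply/seteqP; split => [x|_ [M + <-]] /=.
    rewrite -[x]coset_liftK => /(hit_setP pt_coset)[q Eq].
    exists (coset_lift x * g^-1)%g; last by rewrite mulgVK.
    by apply/(hit_setP pt_coset); exists q; apply/Eg; rewrite mulgVK.
  move=> /(hit_setP pt_coset)[q Eq]; apply/(hit_setP pt_coset).
  by exists q; apply/Eg.
have cvg0 : mu (hit_set (f := f) pt (E k)) @[k --> \oo] --> 0%E.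
  apply: (hit_set_cvg0 pt_continuous pt_coset
    (@adele_box_open R _ (rho * 2 ^+ n.+2 + 2) m)).
  - by move=> M; exact: pt_finite.
  - by move=> k; apply: measurable_window => //; exact: measurable_shell.
  - move=> k; apply: shell_window_box; first exact: exprn_ege1.
      by rewrite ler_pM2l // lerXn2r // nnegrE // ltW.
    by rewrite mulr_ge0 // ?exprn_ge0 // ltW.
  (* y lies in at most one [E k]: as y_1 > 0, its slope determines the scale. Hence the threshold
     [k0.+1]. *)
  move=> y; have [[k0 Ek0]|nE] := pselect (exists k, E k y); last first.
    by exists 0%N => k _ Ek; apply: nE; exists k.
  exists k0.+1 => k k0k [[/andP[cy _] /andP[l1 h1]] _].
  have [[_ /andP[l2 h2]] _] := Ek0.
  have y0 : 0 < pi_inf y 0 0.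
    by rewrite -(pmulr_rgt0 _ (exprn_gt0 n.+1 (s0 k))); exact: le_lt_trans cy.
  have : rho * s k ^+ n.+2 * pi_inf y 0 0 = rho * s k0 ^+ n.+2 * pi_inf y 0 0.
    by apply: le_anti; rewrite (le_trans l1 h2) (le_trans l2 h1).
  move=> /(mulIf (lt0r_neq0 y0)) /(mulfI (lt0r_neq0 rho0)) /eqP.
  rewrite eqrXn2 ?(ltW (s0 _)) // => /eqP /addrI /invr_inj /eqP.
  by rewrite eqr_nat eqSS => /eqP kk; rewrite kk ltnn in k0k.
have : mu (hit_set (f := f) pt (E k)) @[k --> \oo] -->
    mu (hit_set (f := f) pt (window (shell c 1 rho rho) W)).
  by rewrite (_ : (fun k => mu _) = cst (mu (hit_set (f := f) pt (window (shell c 1 rho rho) W))));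
    [exact: cvg_cst|apply/funext => k; exact: hitE].
by move=> /(cvg_unique (@ereal_hausdorff R) cvg0).
Qed.

Lemma cone_count_continuous (rho : R) r : 0 < rho ->
  {for rho, continuous (fun rho => fine (mu (cone_count rho r)))}.
Proof.
move=> rho0; pose w k : R := k.+1%:R^-1.
have w0 k : 0 < w k by rewrite invr_gt0.
have w1 k : w k <= 1 by rewrite invf_le1 // ler1n.
pose E k := window (shell c 1 (rho - w k) (rho + w k) `\` shell c 1 rho rho) W.
pose Z := window (shell c 1 rho rho) W.
(* All slopes below are at most rho + 1, as [w k <= 1]; the 2 comes from [shell_bounded]. *)
have Obox := @adele_box_open R n.+2 (rho + 1 + 2) m.
have Ofin M := pt_finite M (rho + 1 + 2) m_gt0.
have mE k : measurable (E k : set (borel _)).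
  by apply: measurable_window => //; apply: measurableD; exact: measurable_shell.
have rho1 : 0 <= rho + 1 by rewrite addr_ge0 // ltW.
have EO k : E k `<=` adele_box (rho + 1 + 2) m.
  move=> x [[Kx _] Wx]; apply: (@shell_window_box 1 (rho - w k) (rho + w k)) => //.
  by rewrite lerD2l.
have mZ : measurable (hit_set (f := f) pt Z).
  apply: (measurable_hit_set R pt_continuous pt_coset Obox Ofin).
    by apply: measurable_window => //; exact: measurable_shell.
  by apply: shell_window_box => //; rewrite lerDl.
have mhE k : measurable (hit_set (f := f) pt (E k)).
  exact: (measurable_hit_set R pt_continuous pt_coset Obox Ofin).
have mcount (rho' : R) : rho' <= rho + 1 -> measurable (cone_count rho' r).
  move=> rho'1; rewrite cone_countE.
  apply: (measurable_hits_card R pt_continuous pt_coset Obox Ofin).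
    by apply: measurable_window => //; exact: measurable_shell.
  exact: shell_window_box.
have cvg0 : mu (hit_set (f := f) pt (E k)) @[k --> \oo] --> 0%E.
  apply: (hit_set_cvg0 pt_continuous pt_coset Obox Ofin mu mE EO) => y.
  (* v measures the distance of y from the surface. Membership in [E k] forces 0 < v <= w k t, which
     fails once k + 1 > t / v. *)
  pose t := pi_inf y 0 0; pose v := `|norm2 (col' 0 (pi_inf y)) - rho * t|.
  exists (Num.bound (t / v)) => k hk [[[cy /andP[l h]] nS] _].
  rewrite -/t in l h; have t0 : 0 < t.
    by move: (cy); rewrite mul1r => /andP[+ _]; exact: le_lt_trans.
  have v0 : 0 < v.
    rewrite normr_gt0 subr_eq0; apply/eqP => e; apply: nS; split => //.
    by rewrite e !lexx.
  have vt : v <= w k * t.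
    by rewrite ler_norml; apply/andP; split; rewrite mulrDl ?mulrBl in l h *; lra.
  have : t / v < k.+1%:R.
    apply: lt_le_trans (archi_boundP _) _; first by rewrite divr_ge0 // ltW.
    by rewrite ler_nat leqW.
  rewrite ltr_pdivrMr // => tk.
  suff : k.+1%:R * v <= t by rewrite leNgt tk.
  by rewrite -ler_pdivlMl //.
apply/cvgrPdist_le => e e0.
have [k ke] : exists k, fine (mu (hit_set (f := f) pt (E k))) <= e.
  have fc : fine (mu (hit_set (f := f) pt (E k))) @[k --> \oo] --> (0 : R).
    exact: fine_cvg cvg0.
  have /cvgrPdist_le/(_ e e0)[k _ /(_ k (leqnn k))] /= := fc.
  by rewrite sub0r normrN => /(le_trans (ler_norm _)) ?; exists k.
have : \forall rho' \near rho, `|rho - rho'| <= w k.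
  by have /cvgrPdist_le := @cvg_id _ (nbhs rho); apply.
apply: filterS => rho' /= rhok.
have wk := w1 k; have wk0 := w0 k.
move: rhok; rewrite ler_norml => /andP[d1 d2].
have rho'1 : rho' <= rho + 1 by lra.
have mA := mcount rho; rewrite lerDl ler01 in mA; have {}mA := mA isT.
have mB := mcount _ rho'1.
have mC := measurableU _ _ (mhE k) mZ.
(* An index can enter or leave the cone only if its point lies in the shell, that is, in [E k] or on
   the surface. *)
have same x : ~ (hit_set (f := f) pt (E k) `|` hit_set (f := f) pt Z) x ->
    hits pt (window (shell c 1 0 rho) W) (coset_lift x) =
    hits pt (window (shell c 1 0 rho') W) (coset_lift x).
  move=> nx.
  have key rho1' rho2' q : rho - w k <= rho1' <= rho + w k ->
      rho - w k <= rho2' <= rho + w k ->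
      window (shell c 1 0 rho1') W (pt q (coset_lift x)) ->
      window (shell c 1 0 rho2') W (pt q (coset_lift x)).
    move=> r1 r2 [Kq Wq]; split => //; apply: contrapT => nK.
    have S := shell_diff c_ge0 r1 r2 Kq nK.
    apply: nx; have [SZ|nSZ] := pselect (shell c 1 rho rho (pi_inf (pt q (coset_lift x)))).
      by right; exists q; split.
    by left; exists q; split.
  by apply/seteqP; split => q; apply: key; apply/andP; split; lra.
apply: le_trans (probability_dist_le mu mA mB mC _ _) _.
- move=> x; rewrite !cone_countE /= => xr.
  have [|/same e'] := pselect ((hit_set (f := f) pt (E k) `|` hit_set (f := f) pt Z) x).
    by right.
  by left; rewrite /= -e'.
- move=> x; rewrite !cone_countE /= => xr.
  have [|/same e'] := pselect ((hit_set (f := f) pt (E k) `|` hit_set (f := f) pt Z) x).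
    by right.
  by left; rewrite /= e'.
apply: le_trans ke; apply: fine_le; rewrite ?fin_num_measure //.
(* The surface contributes 0, which leaves the probability of hitting [E k]. *)
apply: le_trans (measureU2 mu (mhE k) mZ) _.
rewrite -[leRHS]adde0; apply: leeD => //.
have Z0 : (mu (hit_set (f := f) pt Z) <= 0)%E by rewrite cone_surface_null.
exact: Z0.
Qed.

End cone_counts.

(** * Volume and real powers *)

Lemma vol_ge0 (R : realType) n (S : set 'rV[R]_n) : (0 <= vol S)%E.
Proof.
apply: le_ereal_inf_tmp => _ [F _ <-]; apply: nneseries_ge0 => k _ _.
by rewrite lee_fin; apply: prodr_ge0 => i _; rewrite le_max lexx.
Qed.

(** The power is exp(y ln t) for t > 0, and positivity persists near x. *)
Lemma powR_continuous (R : realType) (y x : R) : 0 < x ->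
  {for x, continuous (fun t => t `^ y)}.
Proof.
move=> x0.
have powE t : 0 < t -> t `^ y = expR (y * ln t) by move=> t0; rewrite /powR gt_eqF.
have ev : \forall t \near x, expR (y * ln t) = t `^ y.
  have : \forall t \near x, 0 < t by apply: open_nbhs_nbhs; split => //; exact: open_gt.
  by apply: filterS => t /powE.
rewrite /prop_for /continuous_at powE //; apply: cvg_trans (near_eq_cvg ev) _.
have lnc := continuous_comp (continuous_ln x0) (@mulrl_continuous _ y (ln x)).
exact: (continuous_comp lnc (@continuous_expR R _)).
Qed.

Lemma pair_cst_continuous (S T : topologicalType) (t : T) :
  continuous (fun x : S => (x, t)).
Proof. by move=> x; apply: cvg_pair; [exact: cvg_id|exact: cvg_cst]. Qed.

(** * Lattice points for the linear and affine groups *)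

Section SL_points.
Variables (R : realType) (d : nat).

Definition SL_point (q : 'rV[rat]_d) (M : SL d (adele R)) : 'rV[adele R]_d :=
  delta R q *m val M.

(** With SL_d inside ASL_d, continuity, finiteness and injectivity carry over from the affine
    case. *)
Lemma SL_pointE q M : SL_point q M = ASL_act (delta R q) (M, 0).
Proof. by rewrite /ASL_act addr0. Qed.

Lemma SL_point_continuous q : continuous (SL_point q).
Proof.
have -> : SL_point q = (fun M => ASL_act (delta R q) (M, 0)).
  by apply/funext => M; exact: SL_pointE.
have ic : continuous (fun M : SL d (adele R) => (M, 0) : ASL d (adele R)).
  exact: pair_cst_continuous.
move=> M; exact: (continuous_comp (ic M) (@ASL_act_continuous R d _ _)).
Qed.

(** Right multiplication by the rational matrix h permutes Q^d. *)
Lemma SL_point_coset (h : SL d rat) :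
  exists2 tau : 'rV[rat]_d -> 'rV[rat]_d, bijective tau &
  forall M q, SL_point q (SL_delta R h * M)%g = SL_point (tau q) M.
Proof.
exists (fun q => q *m val h).
  exists (fun q => q *m val (h^-1)%g) => q; rewrite -mulmxA.
    by have /(congr1 val) /= -> := mulgV h; rewrite mulmx1.
  by have /(congr1 val) /= -> := mulVg h; rewrite mulmx1.
by move=> M q; rewrite /SL_point /delta map_mxM mulmxA.
Qed.

End SL_points.

Section ASL_points.
Variables (R : realType) (d : nat).

Definition ASL_point (q : 'rV[rat]_d) (M : ASL d (adele R)) : 'rV[adele R]_d :=
  ASL_act (delta R q) M.

Lemma ASL_point_coset (h : ASL d rat) :
  exists2 tau : 'rV[rat]_d -> 'rV[rat]_d, bijective tau &
  forall M q, ASL_point q (ASL_delta R h * M)%g = ASL_point (tau q) M.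
Proof.
have act1 (q : 'rV[rat]_d) : ASL_act q 1%g = q by rewrite /ASL_act mulmx1 addr0.
exists (fun q => ASL_act q h).
  by exists (fun q => ASL_act q (h^-1)%g) => q; rewrite -ASL_actM ?mulgV ?mulVg act1.
move=> M q; rewrite /ASL_point ASL_actM; congr ASL_act.
by rewrite /ASL_act /delta map_mxD map_mxM.
Qed.

End ASL_points.

(** * Translated windows and continuity in sigma *)

Lemma fin_adele_translate_continuous d (v : 'rV[fin_adele]_d) :
  continuous (fun x : 'rV[fin_adele]_d => x + v).
Proof.
apply: mx_continuousP => i j.
have -> : (fun x : 'rV[fin_adele]_d => (x + v) i j) = (fun x => x i j + v i j).
  by apply/funext => x; rewrite mxE.
apply: (@continuous_comp2 _ _ _ _ (fun t : fin_adele * fin_adele => t.1 + t.2)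
  (fun x : 'rV[fin_adele]_d => x i j) (fun=> v i j)).
- exact: fin_adele_add_continuous.
- exact: mx_coord_continuous.
- exact: cst_continuous.
Qed.

Section continuity_in_sigma.
Variables (R : realType) (n : nat) (W : set 'rV[fin_adele]_n.+2) (m : nat) (c : R) (r : nat).
Hypothesis W_measurable : measurable (W : set (borel 'rV[fin_adele]_n.+2)).
Hypothesis m_gt0 : (0 < m)%N.
Hypothesis W_denom : forall x, W x -> forall j, fin_adele_int (m%:R * x 0 j).
Hypothesis c_ge0 : 0 <= c.

Lemma SL_count_continuous (mu : probability (borel (SL_space R n.+2)) R) (rho : R) :
  right_invariant mu -> 0 < rho ->
  {for rho, continuous (fun rho => fine (mu (SL_count W (shell c 1 0 rho) r)))}.
Proof.
move=> mu_inv; apply: (@cone_count_continuous R n (SL n.+2 rat) (SL n.+2 (adele R))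
  (@SL_delta R n.+2) (@SL_point R n.+2) _ _ _ _ _ mu W m c mu_inv).
- exact: SL_point_continuous.
- exact: SL_point_coset.
- move=> M B k k0; have := ASL_orbit_finite (M, 0) B k0.
  by apply: sub_finite_set => q; rewrite /= SL_pointE.
- move=> M q q' /=; rewrite !SL_pointE; exact: pi_inf_ASL_act_inj.
- by move=> s s0; exists (real_scaling n s0) => q M; rewrite /SL_point mulmxA.
- exact: W_measurable.
- exact: m_gt0.
- exact: W_denom.
- exact: c_ge0.
Qed.

Lemma ASL_count_continuous (mu : probability (borel (ASL_space R n.+2)) R) (rho : R) :
  right_invariant mu -> 0 < rho ->
  {for rho, continuous (fun rho => fine (mu (ASL_count W (shell c 1 0 rho) r)))}.
Proof.
move=> mu_inv; apply: (@cone_count_continuous R n (ASL n.+2 rat) (ASL n.+2 (adele R))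
  (@ASL_delta R n.+2) (@ASL_point R n.+2) _ _ _ _ _ mu W m c mu_inv).
- by move=> q; exact: ASL_act_continuous.
- exact: ASL_point_coset.
- by move=> M B k k0; exact: ASL_orbit_finite.
- by move=> M; exact: pi_inf_ASL_act_inj.
- move=> s s0; exists (real_scaling n s0, 0) => q M.
  by rewrite /ASL_point ASL_actM {1}/ASL_act addr0.
- exact: W_measurable.
- exact: m_gt0.
- exact: W_denom.
- exact: c_ge0.
Qed.

End continuity_in_sigma.

(** The value kappa = 0 can arise from the conventions for division by 0 and for [fine] of an
    infinite value; the slope is then constant in sigma. *)
Lemma continuous_powR_slope (R : realType) (F : R -> R) (kappa y sigma : R) :
  0 <= kappa -> 0 < sigma ->
  (forall rho, 0 < rho -> {for rho, continuous F}) ->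
  {for sigma, continuous (fun t : R => F ((t * kappa) `^ y))}.
Proof.
rewrite le_eqVlt => /predU1P[<- _ _|kappa0 sigma0 Fc].
  rewrite (_ : (fun t => _) = cst (F (0 `^ y))); first exact: cvg_cst.
  by apply/funext => t; rewrite mulr0.
have sk : 0 < sigma * kappa by rewrite mulr_gt0.
have slope := continuous_comp (@mulrr_continuous _ kappa sigma) (@powR_continuous R y _ sk).
exact: (continuous_comp slope (Fc _ (powR_gt0 y sk))).
Qed.

Theorem theorem10p2 (R : realType) (n : nat)
    (mf : {measure set (borel 'rV[fin_adele]_n.+2) -> \bar R})
    (muSL : probability (borel (SL_space R n.+2)) R)
    (muASL : probability (borel (ASL_space R n.+2)) R)
    (A : SL n.+2 fin_adele) (W : set 'rV[fin_adele]_n.+2)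
    (alpha : 'rV[R]_n.+2) (c : R) :
  normalized_haar mf ->
  right_invariant muSL ->
  right_invariant muASL ->
  compact (closure W) ->
  measurable (W : set (borel 'rV[fin_adele]_n.+2)) ->
  mf (boundary W) = 0%E ->
  (0 < mf W)%E ->
  0 <= c < 1 ->
  forall r : nat,
    {within `]0, +oo[, continuous
      (fun sigma : R => Gfun mf muSL muASL A W alpha c sigma r)}.
Proof.
move=> _ invSL invASL cW mW _ _ /andP[c0 c1] r.
have [m m0 hm] := compact_fin_adele_denom cW.
have Wm x : W x -> forall j, fin_adele_int (m%:R * x 0 j).
  by move=> Wx; apply: hm; exact: subset_closure.
apply: continuous_in_subspaceT => sigma; rewrite inE /= in_itv /= andbT => sigma0.
(* Everything under the root except sigma: the slope is (sigma kappa)^(1/(d-1)). *)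
pose kappa := n.+2%:R / ((1 - c ^+ n.+2) * fine (mf W) * fine (vol (@unit_ball R n.+1))).
have kappa0 : 0 <= kappa.
  rewrite divr_ge0 // !mulr_ge0 //.
  - by rewrite subr_ge0 exprn_ile1 // ltW.
  - by rewrite fine_ge0 // vol_ge0.
have coneE t : cone (n := n) (fine (mf W)) c t = shell c 1 0 ((t * kappa) `^ (n.+1%:R)^-1).
  by rewrite cone_shell // /kappa mulrA.
rewrite /Gfun; case: pselect => [aQ|naQ]; last first.
  rewrite (_ : (fun t => _) = (fun t => fine (muASL
    (ASL_count W (shell c 1 0 ((t * kappa) `^ (n.+1%:R)^-1)) r)))); last first.
    by apply/funext => t; rewrite coneE.
  apply: (@continuous_powR_slope R
    (fun rho => fine (muASL (ASL_count W (shell c 1 0 rho) r)))) => // rho.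
  exact: (@ASL_count_continuous R n W m c r mW m0 Wm c0 muASL rho invASL).
(* The shifted window is W - v. With k clearing the denominators of v, m k is a common denominator
   for it. *)
pose v := pi_int (sval (cid2 aQ)) *m val A.
have [k k0 hk] := fin_adele_denom_fin (fun j => v 0 j).
have WvE : shifted_window A W (sval (cid2 aQ)) = (fun x => x + v) @^-1` W.
  apply/seteqP; split => [_ [x Wx <-]|x Wx] /=; first by rewrite subrK.
  by exists (x + v) => //; rewrite addrK.
have mWv : measurable (shifted_window A W (sval (cid2 aQ)) : set (borel _)).
  rewrite WvE; apply: (borel_preimage _ mW); exact: fin_adele_translate_continuous.
have Wvm x : shifted_window A W (sval (cid2 aQ)) x ->
    forall j, fin_adele_int ((m * k)%:R * x 0 j).
  rewrite WvE => Wx j.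
  have -> : x 0 j = (x + v) 0 j - v 0 j by rewrite mxE addrK.
  rewrite mulrBr.
  apply: fin_adele_intD; first by apply: fin_adele_int_dvd (Wm _ Wx j); exact: dvdn_mulr.
  by apply: fin_adele_intN; apply: fin_adele_int_dvd (hk j); exact: dvdn_mull.
have mk0 : (0 < m * k)%N by rewrite muln_gt0 m0.
rewrite (_ : (fun t => _) = (fun t => fine (muSL
  (SL_count (shifted_window A W (sval (cid2 aQ)))
    (shell c 1 0 ((t * kappa) `^ (n.+1%:R)^-1)) r)))); last first.
  by apply/funext => t; rewrite coneE.
apply: (@continuous_powR_slope R
  (fun rho => fine (muSL (SL_count (shifted_window A W (sval (cid2 aQ)))
    (shell c 1 0 rho) r)))) => // rho.
exact: (@SL_count_continuous R n _ (m * k) c r mWv mk0 Wvm c0 muSL rho invSL).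
Qed.
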